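(* Let $\lambda\ge 0$ be a real number and let $f(z)=h(z)+\overline{g(z)}=\sum_{n=1}^\infty a_nz^n+\sum_{n=1}^\infty\overline{b_n}\,\overline{z}^n\in\mathcal{B}_H(\lambda)$. Then for every $z\in\mathbb{D}$, $$\big|\,|h'(z)|-|g'(z)|\,\big|\ge\big|1-|b_1|\big|\left(\frac{1-|z|}{1+|z|}\right)^{\lambda}=\big|1-|b_1|\big|\,H_\lambda'(-|z|),$$ $$|h'(z)|+|g'(z)|\le(1+|b_1|)\left(\frac{1+|z|}{1-|z|}\right)^{\lambda}=(1+|b_1|)\,H_\lambda'(|z|),$$ and $$|f(z)|\le(1+|b_1|)\,H_\lambda(|z|).$$ Furthermore, if $f\in\mathcal{S}_H^0\cap\mathcal{B}_H(\lambda)$, then for every $z\in\mathbb{D}$, $$-H_\lambda(-|z|)\le|f(z)|\le H_\lambda(|z|).$$ Equality occurs in each case for functions of the form $f(z)=\overline{\mu}H_\lambda(\mu z)$ with $\mu$ a unimodular constant; that is, for each of these inequalities and each $z_0\in\mathbb{D}$ there is a constant $\mu$ with $|\mu|=1$ such that equality holds at $z=z_0$ for $f(z)=\overline{\mu}H_\lambda(\mu z)$.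
   Context: $\mathbb{D}$ is the open unit disk. $\mathcal{H}$ is the class of harmonic mappings $f=h+\overline g$ in $\mathbb{D}$ ($h,g$ analytic) with $h(0)=g(0)=h'(0)-1=0$; thus $a_1=1$ and $b_1=g'(0)$. $\|T_f\|=\sup_{z\in\mathbb{D},\ \theta\in[0,2\pi]}(1-|z|^2)\left|\frac{h''(z)+e^{i\theta}g''(z)}{h'(z)+e^{i\theta}g'(z)}\right|$, with $\|T_f\|=\infty$ if $h'+e^{i\theta}g'$ has a zero in $\mathbb{D}$ for some $\theta$; and $\mathcal{B}_H(\lambda)=\{f\in\mathcal{H}:\|T_f\|\le 2\lambda\}$ for $\lambda\ge0$. $\mathcal{S}_H^0$ is the set of $f\in\mathcal{H}$ that are sense-preserving (i.e. $|g'|<|h'|$ in $\mathbb{D}$) and univalent in $\mathbb{D}$ with $g'(0)=0$. $H_\lambda(z)=\int_0^z\left(\frac{1+t}{1-t}\right)^{\lambda}dt$ for $z\in\mathbb{D}$ (principal branch). *)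

(* Defs.v *)
From Stdlib Require Import Reals Lra ClassicalEpsilon.
From Coquelicot Require Import Coquelicot.
Open Scope R_scope.

Definition in_disk (z : C) : Prop := Cmod z < 1.

Definition Cexp (z : C) : C :=
  (exp (Re z) * cos (Im z), exp (Re z) * sin (Im z)).

(* The argument in ]-PI, PI] of z <> 0; no meaning at z = 0. *)
Definition Carg (z : C) : R :=
  if Rle_dec 0 (Im z) then acos (Re z / Cmod z) else - acos (Re z / Cmod z).

Definition Clog (z : C) : C := (ln (Cmod z), Carg z).

Definition Cpower (z w : C) : C := Cexp (w * Clog z)%C.

(* Integral from 0 to z, taken along the segment t = s z with 0 <= s <= 1. *)
Definition Hfun (lambda : R) (z : C) : C :=
  RInt (V := C_R_CompleteNormedModule)
    (fun s : R => (z * Cpower ((1 + s * z) / (1 - s * z)) lambda)%C) 0 1.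

Definition analytic (h : C -> C) : Prop :=
  forall z : C, in_disk z ->
    ex_derive (K := C_AbsRing) (V := C_NormedModule) h z.

(* The harmonic mapping f comes with its decomposition f = h + conj g,
   which g 0 = 0 makes unique on the disk. *)
Definition in_H (f h g : C -> C) : Prop :=
  analytic h /\ analytic g /\
  (forall z : C, in_disk z -> f z = (h z + Cconj (g z))%C) /\
  h 0 = 0 /\ g 0 = 0 /\ C_derive h 0 = 1.

Definition T_den (h g : C -> C) (theta : R) (z : C) : C :=
  (C_derive h z + Cexp (Ci * theta) * C_derive g z)%C.

Definition T_num (h g : C -> C) (theta : R) (z : C) : C :=
  (C_derive (C_derive h) z + Cexp (Ci * theta) * C_derive (C_derive g) z)%C.

Definition T_norm (h g : C -> C) : Rbar :=
  if excluded_middle_informative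
       (exists (theta : R) (z : C),
          0 <= theta <= 2 * PI /\ in_disk z /\ T_den h g theta z = 0)
  then p_infty
  else Lub_Rbar (fun r : R =>
         exists (z : C) (theta : R),
           in_disk z /\ 0 <= theta <= 2 * PI /\
           r = (1 - Cmod z ^ 2) * Cmod (T_num h g theta z / T_den h g theta z)).

Definition in_BH (lambda : R) (f h g : C -> C) : Prop :=
  in_H f h g /\ Rbar_le (T_norm h g) (2 * lambda).

Definition in_SH0 (f h g : C -> C) : Prop :=
  in_H f h g /\
  (forall z : C, in_disk z -> Cmod (C_derive g z) < Cmod (C_derive h z)) /\
  (forall z w : C, in_disk z -> in_disk w -> f z = f w -> z = w) /\
  C_derive g 0 = 0.

(* a 0 plays no role: the sums start at n = 1. *)
Definition has_expansion (h : C -> C) (a : nat -> C) : Prop :=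
  forall z : C, in_disk z ->
    is_series (K := C_AbsRing) (V := C_NormedModule)
      (fun n : nat => (a (S n) * z ^ S n)%C) (h z).

Definition extremal (lambda : R) (mu z : C) : C :=
  (Cconj mu * Hfun lambda (mu * z))%C.

(* On ]-1, 1[ the function is real-valued, so that "Re (Hfun lambda r)" is its
   value there and not merely a part of it. *)
Lemma Cpower_pos (x y : R) : 0 < x -> Cpower x y = Rpower x y.
Proof.
intros Hx.
assert (Hm : Cmod x = x) by (rewrite Cmod_R; apply Rabs_pos_eq; lra).
assert (HL : Clog x = ln x).
{ unfold Clog, Carg. rewrite Hm. unfold RtoC at 1; simpl.
  destruct (Rle_dec 0 0) as [_|n]; [|lra].
  unfold RtoC. f_equal. replace (x / x) with 1 by (field; lra). apply acos_1. }
unfold Cpower. rewrite HL, <- RtoC_mult.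
unfold Cexp, Rpower. simpl. rewrite cos_0, sin_0.
unfold RtoC. f_equal; ring.
Qed.

Lemma Hfun_real (lambda r : R) : -1 < r < 1 ->
  Hfun lambda r = RInt (fun t : R => Rpower ((1 + t) / (1 - t)) lambda) 0 r.
Proof.
intros Hr.
assert (Hs : forall s, 0 <= s <= 1 -> -1 < s * r < 1) by (intros s Hs; nra).
set (p := fun t : R => Rpower ((1 + t) / (1 - t)) lambda).
assert (Hp : forall t, -1 < t < 1 -> continuous p t).
{ intros t Ht. unfold p, Rpower.
  assert (0 < (1 + t) / (1 - t)) by (apply Rdiv_lt_0_compat; lra).
  apply (ex_derive_continuous (K := R_AbsRing) (V := R_NormedModule)).
  auto_derive. split; [lra|]. split; [|exact I]. exact H. }
assert (Hi : is_RInt (fun s => scal r (p (r * s + 0))) 0 1 (RInt p 0 r)).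
{ apply (is_RInt_comp_lin (V := R_NormedModule) p r 0 0 1).
  replace (r * 0 + 0) with 0 by ring. replace (r * 1 + 0) with r by ring.
  apply (RInt_correct (V := R_CompleteNormedModule)).
  apply (ex_RInt_continuous (V := R_CompleteNormedModule)).
  intros z Hz. apply Hp.
  unfold Rmin, Rmax in Hz. destruct (Rle_dec 0 r); lra. }
unfold Hfun. apply (is_RInt_unique (V := C_R_CompleteNormedModule)).
apply (is_RInt_ext (V := C_R_NormedModule)
         (fun s => (scal r (p (r * s + 0)), 0) : C)).
{ intros s Hs0. rewrite Rmin_left, Rmax_right in Hs0 by lra.
  assert (H1 : -1 < s * r < 1) by (apply Hs; lra).
  assert (0 < (1 + s * r) / (1 - s * r)) by (apply Rdiv_lt_0_compat; lra).
  rewrite <- RtoC_mult, <- RtoC_plus, <- RtoC_minus, <- RtoC_div by lra.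
  rewrite Cpower_pos by assumption. rewrite <- RtoC_mult.
  unfold p. replace (r * s + 0) with (s * r) by ring. reflexivity. }
apply (is_RInt_fct_extend_pair (U := R_NormedModule) (V := R_NormedModule)).
- exact Hi.
- simpl. generalize (is_RInt_const (V := R_NormedModule) 0 1 0).
  unfold scal; simpl; unfold mult; simpl. rewrite Rmult_0_r. exact (fun H => H).
Qed.

(* Main.v *)
Require Import Defs.
From Stdlib Require Import Reals Lra Lia Classical ClassicalEpsilon.
From Coquelicot Require Import Coquelicot.
Open Scope R_scope.

(** Write k(t) = ((1 + t) / (1 - t))^lambda, so that H' = k.

    Distortion. For each theta the function F = h' + exp(i theta) g' has no zero
    in the disk and (1 - |z|^2) |F'/F| <= 2 lambda, so along the radius to z the
    logarithm of |F| changes at most at the rate 2 lambda r / (1 - t^2 r^2),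
    where r = |z|; integrating, |F(z)| lies between |F(0)| / k(r) and |F(0)| k(r)
    ([preschwarzian_distortion]). The angle theta can be chosen to make
    |F(z)| equal to |h'(z)| + |g'(z)|, or equal to | |h'(z)| - |g'(z)| |, while
    F(0) = 1 + exp(i theta) b_1 has modulus between |1 - |b_1|| and 1 + |b_1|
    ([BH_distortion]). Integrating the upper bound along the radius bounds |f|
    ([harmonic_growth]).

    Lower growth of a univalent f. Let r be in ]0, 1[ and let w1 be a value of f
    of least modulus on |z| = r. The image of the closed disk of radius r
    contains the whole segment [0, w1] ([segment_in_image]), and a point moving
    along that segment has a preimage whose speed is at most
    1 / (|h'| - |g'|) <= k(|z|). Hence the length |w1| of the segment is at least
    the integral of 1/k from 0 to r, which is - H(-r)
    ([univalent_harmonic_lower_growth]). Both steps are variational: the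
    differential of f is invertible, so |f - q| has no interior minimum except at
    a solution of f = q; this takes the place of the inverse function theorem and of degree theory.

    Two ingredients come from complex analysis. The second derivatives in the
    definition of the norm make sense because a power series can be
    differentiated term by term ([is_derive_psum]). The complex derivative of H,
    an integral over a segment that moves with its endpoint, is k
    ([Hfun_derive]); its restriction to the real axis gives the comparison
    functions, and its rotations give the extremal mappings, for which
    H''/H' = 2 lambda / (1 - z^2). *)

(** * Moduli and complex derivatives *)

(** Differentiation over C uses a norm topology on the source and a product
    topology on the target, hence the two explicit structures. *)
Notation is_derive_C f z l :=
  (is_derive (K := C_AbsRing) (V := C_NormedModule) f (z : C) (l : C)).
(** Curves in C seen as a real normed space. *)
Notation is_derive_RC G t l :=
  (is_derive (K := R_AbsRing) (V := C_R_NormedModule) G (t : R) (l : C)).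

Lemma Cmod_le_abs (x y : R) : Cmod (x, y) <= Rabs x + Rabs y.
Proof.
replace ((x, y) : C) with (RtoC x + Ci * RtoC y)%C by (apply injective_projections; simpl; ring).
eapply Rle_trans; [apply Cmod_triangle|]. rewrite Cmod_mult, Cmod_Ci, !Cmod_R. lra.
Qed.

Lemma im_le_Cmod (c : C) : Rabs (Im c) <= Cmod c.
Proof. eapply Rle_trans; [|apply Rmax_Cmod]. apply Rmax_r. Qed.

Lemma Rabs_Cmod_minus (z w : C) : Rabs (Cmod w - Cmod z) <= Cmod (w - z).
Proof.
apply Rabs_le_between. split.
- assert (T := Cmod_triangle (z - w) w). replace (z - w + w)%C with z in T by ring.
  replace (z - w)%C with (- (w - z))%C in T by ring. rewrite Cmod_opp in T. lra.
- assert (T := Cmod_triangle (w - z) z). replace (w - z + z)%C with w in T by ring. lra.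
Qed.

Lemma in_disk_0 : in_disk 0.
Proof. unfold in_disk. rewrite Cmod_0. lra. Qed.

Lemma in_disk_R (x : R) : -1 < x < 1 -> in_disk x.
Proof. intros H. unfold in_disk. rewrite Cmod_R. apply Rabs_lt_between. exact H. Qed.

Lemma is_derive_C_eps (f : C -> C) (z l : C) :
  is_derive_C f z l <->
  forall eps : R, 0 < eps -> exists delta : R, 0 < delta /\
    forall w : C, Cmod (w - z) < delta ->
      Cmod (f w - f z - (w - z) * l) <= eps * Cmod (w - z).
Proof.
split.
- intros [_ H] eps Heps.
  destruct (H z (fun P HP => HP) (mkposreal eps Heps)) as [d Hd].
  exists d. split; [apply cond_pos|]. intros w Hw. exact (Hd w Hw).
- intros H. split; [apply is_linear_scal_l|].
  intros x Hx eps.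
  apply (is_filter_lim_locally_unique (V := AbsRing_NormedModule C_AbsRing) z x) in Hx. subst x.
  destruct (H eps (cond_pos eps)) as [d [Hd1 Hd2]].
  exists (mkposreal d Hd1). intros w Hw. exact (Hd2 w Hw).
Qed.

Lemma is_derive_RC_eps (G : R -> C) (t : R) (l : C) :
  is_derive_RC G t l <->
  forall eps : R, 0 < eps -> exists delta : R, 0 < delta /\
    forall s : R, Rabs (s - t) < delta ->
      Cmod (G s - G t - (RtoC (s - t)) * l) <= eps * Rabs (s - t).
Proof.
assert (E : forall s, Cmod (G s - G t - (RtoC (s - t)) * l)
   = norm (V := C_R_NormedModule) (minus (minus (G s) (G t)) (scal (minus s t : R) l))).
{ intros s. rewrite Cmod_norm. f_equal.
  unfold minus, plus, opp, scal; simpl.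
  unfold prod_plus, prod_opp, prod_scal, scal, plus, opp; simpl.
  unfold mult; simpl.
  apply injective_projections; simpl; ring. }
split.
- intros [_ H] eps Heps.
  destruct (H t (fun P HP => HP) (mkposreal eps Heps)) as [d Hd].
  exists d. split; [apply cond_pos|]. intros w Hw. rewrite E. exact (Hd w Hw).
- intros H. split; [apply is_linear_scal_l|].
  intros x Hx eps.
  apply (is_filter_lim_locally_unique (V := AbsRing_NormedModule R_AbsRing) t x) in Hx. subst x.
  destruct (H eps (cond_pos eps)) as [d [Hd1 Hd2]].
  exists (mkposreal d Hd1). intros w Hw.
  specialize (Hd2 w Hw). rewrite E in Hd2. exact Hd2.
Qed.

(** The product rule and the chain rule are available for functions into a ring
    seen as a module over itself, a structure on C that is not convertible to
    [C_NormedModule] although its norm is the same. *)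
Lemma is_derive_C_AbsRing (f : C -> C) (z l : C) :
  is_derive_C f z l <->
  is_derive (K := C_AbsRing) (V := AbsRing_NormedModule C_AbsRing) f z l.
Proof.
split; intros [_ H].
- split; [apply (is_linear_scal_l (V := AbsRing_NormedModule C_AbsRing))|exact H].
- split; [apply (is_linear_scal_l (V := C_NormedModule))|exact H].
Qed.

Lemma is_derive_C_mult (f g : C -> C) (z df dg : C) :
  is_derive_C f z df -> is_derive_C g z dg ->
  is_derive_C (fun w => f w * g w)%C z (df * g z + f z * dg)%C.
Proof.
intros Hf Hg. apply is_derive_C_AbsRing.
apply is_derive_C_AbsRing in Hf. apply is_derive_C_AbsRing in Hg.
apply (is_derive_mult (K := C_AbsRing) f g); auto.
intros n m. apply Cmult_comm.
Qed.

Lemma is_derive_C_comp (f g : C -> C) (z df dg : C) :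
  is_derive_C f (g z) df -> is_derive_C g z dg ->
  is_derive_C (fun w => f (g w)) z (dg * df)%C.
Proof. intros Hf Hg. apply is_derive_C_AbsRing in Hg. exact (is_derive_comp f g z df dg Hf Hg). Qed.
Lemma is_derive_C_plus (f g : C -> C) (z df dg : C) :
  is_derive_C f z df -> is_derive_C g z dg ->
  is_derive_C (fun w => f w + g w)%C z (df + dg)%C.
Proof. intros Hf Hg. exact (is_derive_plus f g z df dg Hf Hg). Qed.
Lemma is_derive_C_id (z : C) : is_derive_C (fun w => w) z 1%C.
Proof. apply is_derive_C_AbsRing. exact (is_derive_id (K := C_AbsRing) z). Qed.
Lemma is_derive_C_const (c z : C) : is_derive_C (fun _ => c) z 0%C.
Proof. exact (is_derive_const (K := C_AbsRing) (V := C_NormedModule) c z). Qed.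

Lemma Cinv_derive (z : C) : z <> 0 -> is_derive_C Cinv z (- / (z * z))%C.
Proof.
intros Hz. apply is_derive_C_eps. intros eps Heps.
assert (Hm : 0 < Cmod z) by (apply Cmod_gt_0; exact Hz).
exists (Rmin (Cmod z / 2) (eps * (Cmod z ^ 3) / 2)).
assert (0 < Cmod z ^ 3) by (apply pow_lt; lra).
split. { apply Rmin_pos; [lra|]. assert (0 < eps * Cmod z ^ 3) by (apply Rmult_lt_0_compat; lra). lra. }
intros w Hw.
assert (Hw1 := Rlt_le_trans _ _ _ Hw (Rmin_l _ _)).
assert (Hw2 := Rlt_le_trans _ _ _ Hw (Rmin_r _ _)).
assert (Hwm : Cmod z / 2 < Cmod w).
{ assert (T := Cmod_triangle (z - w) w). replace (z - w + w)%C with z in T by ring.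
  replace (z - w)%C with (- (w - z))%C in T by ring. rewrite Cmod_opp in T. lra. }
assert (w <> 0) by (apply Cmod_gt_0; lra).
replace (/ w - / z - (w - z) * - / (z * z))%C with ((w - z) * ((w - z) / (w * (z * z))))%C
  by (field; split; assumption).
rewrite Cmod_mult, Cmod_div by (repeat apply Cmult_neq_0; assumption).
rewrite !Cmod_mult, Rmult_comm. apply Rmult_le_compat_r; [apply Cmod_ge_0|].
assert (P : 0 < Cmod w * (Cmod z * Cmod z)) by (repeat apply Rmult_lt_0_compat; lra).
apply Rle_div_l; [exact P|].
apply Rlt_le. eapply Rlt_le_trans; [apply Hw2|].
assert (Cmod z * Cmod z * (Cmod z / 2) <= Cmod z * Cmod z * Cmod w).
{ apply Rmult_le_compat_l; [nra|lra]. }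
replace (eps * Cmod z ^ 3 / 2) with (eps * (Cmod z * Cmod z * (Cmod z / 2))) by (simpl; field).
apply Rmult_le_compat_l; lra.
Qed.

Lemma is_derive_C_eq (f : C -> C) (z l l' : C) : is_derive_C f z l -> l = l' -> is_derive_C f z l'.
Proof. intros H <-. exact H. Qed.

Lemma is_derive_C_ext (f g : C -> C) (z l : C) :
  (forall w, f w = g w) -> is_derive_C f z l -> is_derive_C g z l.
Proof. intros H. apply is_derive_ext. exact H. Qed.

Lemma is_derive_C_scal (k : C) (f : C -> C) (z l : C) :
  is_derive_C f z l -> is_derive_C (fun w => k * f w)%C z (k * l)%C.
Proof.
intros H. apply (is_derive_C_eq _ _ (0 * f z + k * l)%C); [|ring].
apply (is_derive_C_mult (fun _ => k) f); [apply is_derive_C_const|exact H].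
Qed.

Lemma is_derive_C_unique (f : C -> C) (z l : C) : is_derive_C f z l -> C_derive f z = l.
Proof. apply is_C_derive_unique. Qed.

Lemma is_derive_C_local (f g : C -> C) (z l : C) : in_disk z ->
  (forall w, in_disk w -> f w = g w) -> is_derive_C f z l -> is_derive_C g z l.
Proof.
intros Hz E H. apply is_derive_C_eps. intros eps Heps.
destruct (proj1 (is_derive_C_eps _ _ _) H eps Heps) as [d [Hd H1]].
unfold in_disk in Hz. exists (Rmin d (1 - Cmod z)). split; [apply Rmin_pos; lra|].
intros w Hw. apply Rmin_Rgt_l in Hw. destruct Hw as [W1 W2].
rewrite <- (E z Hz), <- (E w); [apply H1; lra|].
unfold in_disk. replace w with ((w - z) + z)%C by ring. eapply Rle_lt_trans; [apply Cmod_triangle|lra].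
Qed.

(** * Differentiable curves and mean value inequalities *)

Lemma is_derive_RC_continuous (G : R -> C) (t : R) (l : C) :
  is_derive_RC G t l -> continuous (U := C_R_NormedModule) G t.
Proof. intros H. apply (ex_derive_continuous (K := R_AbsRing) (V := C_R_NormedModule)). exists l. exact H. Qed.

Lemma is_derive_RC_line (f : C -> C) (p v l : C) (t : R) :
  is_derive_C f (p + RtoC t * v) l ->
  is_derive_RC (fun s : R => f (p + RtoC s * v)%C) t (v * l)%C.
Proof.
intros H. apply is_derive_RC_eps. intros eps Heps.
assert (Hv := Cmod_ge_0 v).
assert (He : 0 < eps / (1 + Cmod v)) by (apply Rdiv_lt_0_compat; lra).
destruct (proj1 (is_derive_C_eps _ _ _) H _ He) as [d [Hd H1]].
exists (d / (1 + Cmod v)). split; [apply Rdiv_lt_0_compat; lra|].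
intros s Hs.
assert (E : (p + s * v - (p + t * v) = (RtoC (s - t)) * v)%C) by (rewrite RtoC_minus; ring).
assert (Hn : Cmod (p + s * v - (p + t * v)) = Rabs (s - t) * Cmod v) by (rewrite E, Cmod_mult, Cmod_R; reflexivity).
assert (Ha := Rabs_pos (s - t)).
assert (Rabs (s - t) * (1 + Cmod v) < d).
{ apply (Rmult_lt_compat_r (1 + Cmod v)) in Hs; [|lra].
  replace (d / (1 + Cmod v) * (1 + Cmod v)) with d in Hs by (field; lra). exact Hs. }
specialize (H1 (p + s * v)%C). rewrite Hn in H1.
assert (Rabs (s - t) * Cmod v < d) by nra.
specialize (H1 H2). rewrite E in H1.
replace (RtoC (s - t) * (v * l))%C with (RtoC (s - t) * v * l)%C by ring.
eapply Rle_trans; [apply H1|].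
replace (eps / (1 + Cmod v) * (Rabs (s - t) * Cmod v)) with (eps * Rabs (s - t) * (Cmod v / (1 + Cmod v))) by (field; lra).
assert (Cmod v / (1 + Cmod v) <= 1) by (apply Rle_div_l; lra).
assert (0 <= eps * Rabs (s - t)) by (apply Rmult_le_pos; lra). nra.
Qed.

Lemma is_derive_Re_mult (c : C) (G : R -> C) (t : R) (l : C) :
  is_derive_RC G t l -> is_derive (fun s => Re (c * G s)) t (Re (c * l)).
Proof.
intros H. split; [apply is_linear_scal_l|].
intros x Hx eps. apply (is_filter_lim_locally_unique (V := AbsRing_NormedModule R_AbsRing) t x) in Hx. subst x.
assert (Hc := Cmod_ge_0 c).
assert (He : 0 < eps / (1 + Cmod c)) by (apply Rdiv_lt_0_compat; [apply cond_pos|lra]).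
destruct (proj1 (is_derive_RC_eps _ _ _) H _ He) as [d [Hd H1]].
exists (mkposreal d Hd). intros s Hs. specialize (H1 s Hs).
change (Rabs ((Re (c * G s) - Re (c * G t)) - (s - t) * Re (c * l)) <= eps * Rabs (s - t)).
replace (Re (c * G s) - Re (c * G t) - (s - t) * Re (c * l)) with
  (Re (c * (G s - G t - RtoC (s - t) * l))) by (unfold Re; simpl; ring).
eapply Rle_trans; [apply re_le_Cmod|]. rewrite Cmod_mult.
assert (Ha := Rabs_pos (s - t)).
eapply Rle_trans; [apply Rmult_le_compat_l; [apply Cmod_ge_0|apply H1]|].
replace (Cmod c * (eps / (1 + Cmod c) * Rabs (s - t))) with (eps * Rabs (s - t) * (Cmod c / (1 + Cmod c))) by (field; lra).
assert (Cmod c / (1 + Cmod c) <= 1) by (apply Rle_div_l; lra).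
assert (0 <= eps * Rabs (s - t)) by (apply Rmult_le_pos; [apply Rlt_le, cond_pos|lra]). nra.
Qed.

Lemma nonneg_derive_le (u du : R -> R) :
  (forall t, 0 <= t <= 1 -> is_derive u t (du t)) ->
  (forall t, 0 <= t <= 1 -> 0 <= du t) -> u 0 <= u 1.
Proof.
intros H1 H2.
destruct (MVT_gen u 0 1 du) as [c [Hc E]].
- intros x. rewrite Rmin_left, Rmax_right by lra. intros Hx. apply H1. lra.
- intros x. rewrite Rmin_left, Rmax_right by lra. intros Hx.
  apply continuity_pt_filterlim. apply (ex_derive_continuous (K := R_AbsRing) (V := R_NormedModule)). exists (du x). apply H1; lra.
- rewrite Rmin_left, Rmax_right in Hc by lra. specialize (H2 c Hc). lra.
Qed.

(** Apply the real mean value theorem to the component of G in the direction D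
    of the total displacement. *)
Lemma mean_value_curve (G dG : R -> C) (psi dpsi : R -> R) :
  (forall t, 0 <= t <= 1 -> is_derive_RC G t (dG t)) ->
  (forall t, 0 <= t <= 1 -> is_derive psi t (dpsi t)) ->
  (forall t, 0 <= t <= 1 -> Cmod (dG t) <= dpsi t) ->
  Cmod (G 1 - G 0) <= psi 1 - psi 0.
Proof.
intros HG Hpsi Hle.
assert (H0 : psi 0 <= psi 1).
{ apply (nonneg_derive_le _ dpsi Hpsi). intros t Ht. eapply Rle_trans; [apply Cmod_ge_0|apply Hle, Ht]. }
set (D := (G 1 - G 0)%C).
destruct (Req_dec (Cmod D) 0) as [E|NE]; [lra|].
assert (HD := Cmod_ge_0 D).
assert (H : psi 0 * Cmod D - Re (Cconj D * G 0) <= psi 1 * Cmod D - Re (Cconj D * G 1)).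
{ apply (nonneg_derive_le (fun t => psi t * Cmod D - Re (Cconj D * G t))
           (fun t => dpsi t * Cmod D - Re (Cconj D * dG t))).
  - intros t Ht. apply (is_derive_minus (V := R_NormedModule)).
    + assert (H := is_derive_scal_l (V := R_NormedModule) psi t (dpsi t) (Cmod D) (Hpsi t Ht)). exact H.
    + apply is_derive_Re_mult, HG, Ht.
  - intros t Ht.
    assert (A := re_le_Cmod (Cconj D * dG t)). rewrite Cmod_mult, Cmod_conj in A.
    assert (B := Rle_abs (Re (Cconj D * dG t))).
    assert (L := Hle t Ht). nra. }
assert (E : Re (Cconj D * G 1) - Re (Cconj D * G 0) = Cmod D ^ 2).
{ rewrite Cmod2_alt. unfold D, Re, Im; simpl. ring. }
nra.
Qed.

Lemma mean_value_C (f df : C -> C) (z w : C) (B : R) :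
  (forall t, 0 <= t <= 1 -> is_derive_C f (z + RtoC t * (w - z)) (df (z + RtoC t * (w - z))%C)) ->
  (forall t, 0 <= t <= 1 -> Cmod (df (z + RtoC t * (w - z))%C) <= B) ->
  Cmod (f w - f z) <= B * Cmod (w - z).
Proof.
intros H1 H2.
assert (H := mean_value_curve (fun t => f (z + RtoC t * (w - z))%C)
   (fun t => (w - z) * df (z + RtoC t * (w - z)))%C
   (fun t => B * Cmod (w - z) * t) (fun t => B * Cmod (w - z))).
simpl in H. replace (z + 1 * (w - z))%C with w in H by ring.
replace (z + 0 * (w - z))%C with z in H by ring.
replace (B * Cmod (w - z)) with (B * Cmod (w - z) * 1 - B * Cmod (w - z) * 0) by ring. apply H.
- intros t Ht. apply is_derive_RC_line, H1, Ht.
- intros t Ht. auto_derive; [exact I|ring].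
- intros t Ht. rewrite Cmod_mult, Rmult_comm. apply Rmult_le_compat_r; [apply Cmod_ge_0|apply H2, Ht].
Qed.

(** * Minima on compact sets of the plane *)

(** Finitely many of the given neighbourhoods cover K, and the smallest radius
    is then a lower bound of F. Local positivity thus becomes uniform; this is
    the only form in which compactness is used. *)
Lemma bounded_local_lower_bound (K : C -> Prop) (F : C -> R) (B : R) :
  (forall z, K z -> Cmod z <= B) ->
  (forall z, exists delta, 0 < delta /\ forall w, K w -> Cmod (w - z) < delta -> delta <= F w) ->
  exists d, 0 < d /\ forall w, K w -> d <= F w.
Proof.
intros HB HF.
assert (HF' : forall x y : R, {d : posreal | forall w, K w -> Cmod (w - (x, y)) < 2 * d -> d <= F w}).
{ intros x y. apply constructive_indefinite_description.
  destruct (HF (x, y)) as [d [Hd H]].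
  assert (Hd' : 0 < d / 2) by lra. exists (mkposreal _ Hd'). simpl. intros w Kw Hw.
  assert (d <= F w) by (apply H; [exact Kw|lra]). lra. }
destruct (compactness_value_2d (- B) B (- B) B (fun x y => proj1_sig (HF' x y))) as [d Hd].
exists d. split; [apply cond_pos|]. intros [x y] Kw.
assert (Hxy := Rmax_Cmod (x, y)). assert (Hb := HB _ Kw). simpl in Hxy.
assert (Hx : Rabs x <= B) by (eapply Rle_trans; [apply Rmax_l|eapply Rle_trans; eassumption]).
assert (Hy : Rabs y <= B) by (eapply Rle_trans; [apply Rmax_r|eapply Rle_trans; eassumption]).
apply Rabs_le_between in Hx. apply Rabs_le_between in Hy.
apply Rnot_lt_le. intros Hlt. apply (Hd x y Hx Hy).
intros [u [v [_ [_ [H1 [H2 H3]]]]]].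
destruct (HF' u v) as [e He]. simpl in *.
assert (e <= F (x, y)).
{ apply He; [exact Kw|]. 
  replace ((x, y) - (u, v))%C with ((x - u, y - v) : C) by reflexivity.
  eapply Rle_lt_trans; [apply Cmod_le_abs|lra]. }
lra.
Qed.

(** A lower bound of F comes from the local lower bounds of exp F. If the
    infimum were not attained, F minus its infimum would be locally, hence
    uniformly, bounded away from 0. *)
Lemma compact_attains_min (K : C -> Prop) (F : C -> R) (B : R) :
  (exists z, K z) ->
  (forall z, K z -> Cmod z <= B) ->
  (forall z, ~ K z -> exists delta, 0 < delta /\ forall w, Cmod (w - z) < delta -> ~ K w) ->
  (forall z, K z -> forall eps, 0 < eps -> exists delta, 0 < delta /\
     forall w, K w -> Cmod (w - z) < delta -> Rabs (F w - F z) < eps) ->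
  exists z, K z /\ forall w, K w -> F z <= F w.
Proof.
intros [z0 Kz0] HB Hcl Hc.
destruct (bounded_local_lower_bound K (fun z => exp (F z)) B HB) as [d [Hd Hlow]].
{ intros z. destruct (excluded_middle_informative (K z)) as [Kz|Kz].
  - destruct (Hc z Kz 1 Rlt_0_1) as [e [He H]].
    exists (Rmin e (exp (F z - 1))). split; [apply Rmin_pos; [exact He|apply exp_pos]|].
    intros w Kw Hw. eapply Rle_trans; [apply Rmin_r|].
    assert (A : Rabs (F w - F z) < 1) by (apply H; [exact Kw|eapply Rlt_le_trans; [apply Hw|apply Rmin_l]]).
    apply Rabs_lt_between in A. apply Rlt_le, exp_increasing. lra.
  - destruct (Hcl z Kz) as [e [He H]]. exists e. split; [exact He|].
    intros w Kw Hw. destruct (H w Hw Kw). }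
destruct (completeness (fun y => exists w, K w /\ y = - F w)) as [I [HI1 HI2]].
{ exists (- ln d). intros y [w [Kw ->]].
  assert (ln d <= F w). { rewrite <- (ln_exp (F w)). apply ln_le; [exact Hd|apply Hlow, Kw]. } lra. }
{ exists (- F z0), z0. auto. }
assert (HF : forall w, K w -> - I <= F w).
{ intros w Kw. assert (- F w <= I) by (apply HI1; exists w; auto). lra. }
apply NNPP. intros Hno.
assert (Hgt : forall z, K z -> - I < F z).
{ intros z Kz. apply Rnot_le_lt. intros Hle. apply Hno. exists z. split; [exact Kz|].
  intros w Kw. eapply Rle_trans; [apply Hle|apply HF, Kw]. }
destruct (bounded_local_lower_bound K (fun z => F z + I) B HB) as [e [He Hlow2]].
{ intros z. destruct (excluded_middle_informative (K z)) as [Kz|Kz].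
  - assert (G := Hgt z Kz). set (q := (F z + I) / 2). assert (Hq : 0 < q) by (unfold q; lra).
    destruct (Hc z Kz q Hq) as [a [Ha H]].
    exists (Rmin a q). split; [apply Rmin_pos; assumption|].
    intros w Kw Hw. eapply Rle_trans; [apply Rmin_r|].
    assert (A : Rabs (F w - F z) < q) by (apply H; [exact Kw|eapply Rlt_le_trans; [apply Hw|apply Rmin_l]]).
    apply Rabs_lt_between in A. unfold q in *. lra.
  - destruct (Hcl z Kz) as [a [Ha H]]. exists a. split; [exact Ha|].
    intros w Kw Hw. destruct (H w Hw Kw). }
assert (I <= I - e).
{ apply HI2. intros y [w [Kw ->]]. specialize (Hlow2 w Kw). simpl in Hlow2. lra. }
lra.
Qed.

(** * Power series in the unit disk *)

(** The sum is taken coordinatewise so as to be a total function; it has the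
    usual meaning for absolutely convergent series. *)
Definition Cseries (a : nat -> C) : C :=
  (Series (fun n => Re (a n)), Series (fun n => Im (a n))).

Lemma ex_series_Re (a : nat -> C) :
  ex_series (fun n => Cmod (a n)) -> ex_series (fun n => Re (a n)).
Proof.
intros H. apply ex_series_Rabs.
apply (ex_series_le (V := R_CompleteNormedModule) _ (fun n => Cmod (a n))); [|exact H].
intros n. change (Rabs (Rabs (Re (a n))) <= Cmod (a n)). rewrite Rabs_Rabsolu. apply re_le_Cmod.
Qed.

Lemma ex_series_Im (a : nat -> C) :
  ex_series (fun n => Cmod (a n)) -> ex_series (fun n => Im (a n)).
Proof.
intros H. apply ex_series_Rabs.
apply (ex_series_le (V := R_CompleteNormedModule) _ (fun n => Cmod (a n))); [|exact H].
intros n. change (Rabs (Rabs (Im (a n))) <= Cmod (a n)). rewrite Rabs_Rabsolu. apply im_le_Cmod.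
Qed.

Lemma Cseries_ext (a b : nat -> C) : (forall n, a n = b n) -> Cseries a = Cseries b.
Proof. intros H. unfold Cseries. f_equal; apply Series_ext; intros n; rewrite H; reflexivity. Qed.

Lemma Cseries_minus (a b : nat -> C) :
  ex_series (fun n => Cmod (a n)) -> ex_series (fun n => Cmod (b n)) ->
  Cseries (fun n => (a n - b n)%C) = (Cseries a - Cseries b)%C.
Proof.
intros Ha Hb. unfold Cseries.
rewrite (Series_ext _ (fun n => Re (a n) - Re (b n))) by reflexivity.
rewrite (Series_ext (fun n => Im _) (fun n => Im (a n) - Im (b n))) by reflexivity.
rewrite !Series_minus by (apply ex_series_Re || apply ex_series_Im; assumption).
reflexivity.
Qed.

Lemma Cseries_scal (k : C) (a : nat -> C) :
  ex_series (fun n => Cmod (a n)) ->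
  Cseries (fun n => (k * a n)%C) = (k * Cseries a)%C.
Proof.
intros Ha. assert (H1 := ex_series_Re a Ha). assert (H2 := ex_series_Im a Ha).
unfold Cseries.
rewrite (Series_ext _ (fun n => Re k * Re (a n) - Im k * Im (a n))) by reflexivity.
rewrite (Series_ext (fun n => Im _) (fun n => Re k * Im (a n) + Im k * Re (a n))) by reflexivity.
rewrite Series_minus, Series_plus, !Series_scal_l
  by (apply (ex_series_scal (V := R_NormedModule)); assumption).
reflexivity.
Qed.

Lemma Cseries_incr_1 (a : nat -> C) :
  ex_series (fun n => Cmod (a n)) ->
  Cseries a = (a O + Cseries (fun n => a (S n)))%C.
Proof.
intros Ha. unfold Cseries.
rewrite (Series_incr_1 (fun n => Re (a n))) by (apply ex_series_Re, Ha).
rewrite (Series_incr_1 (fun n => Im (a n))) by (apply ex_series_Im, Ha).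
reflexivity.
Qed.

(** The factor 2 comes from bounding the two coordinates separately; any
    constant serves in the proof of differentiability. *)
Lemma Cseries_bound (a : nat -> C) (b : nat -> R) :
  (forall n, Cmod (a n) <= b n) -> ex_series b ->
  Cmod (Cseries a) <= 2 * Series b.
Proof.
intros Hab Hb.
assert (Ha : ex_series (fun n => Cmod (a n))).
{ apply (ex_series_le (V := R_CompleteNormedModule) _ b); [|exact Hb].
  intros n. change (Rabs (Cmod (a n)) <= b n). rewrite Rabs_pos_eq by apply Cmod_ge_0. apply Hab. }
unfold Cseries. eapply Rle_trans; [apply Cmod_le_abs|].
assert (L : forall u : nat -> R, (forall n, Rabs (u n) <= Cmod (a n)) -> Rabs (Series u) <= Series b).
{ intros u Hu. eapply Rle_trans; [apply Series_Rabs|].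
  - apply (ex_series_le (V := R_CompleteNormedModule) _ b); [|exact Hb].
    intros n. change (Rabs (Rabs (u n)) <= b n). rewrite Rabs_Rabsolu.
    eapply Rle_trans; [apply Hu|apply Hab].
  - apply Series_le; [|exact Hb]. intros n. split; [apply Rabs_pos|].
    eapply Rle_trans; [apply Hu|apply Hab]. }
assert (A := L (fun n => Re (a n)) (fun n => re_le_Cmod _)).
assert (B := L (fun n => Im (a n)) (fun n => im_le_Cmod _)).
lra.
Qed.

Lemma is_series_Re_Im (a : nat -> C) (l : C) :
  is_series (K := C_AbsRing) (V := C_NormedModule) a l ->
  is_series (fun n => Re (a n)) (Re l) /\ is_series (fun n => Im (a n)) (Im l).
Proof.
intros H.
assert (HR : forall n, Re (sum_n (G := C_NormedModule) a n) = sum_n (fun n => Re (a n)) n).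
{ induction n as [|n IH]; [rewrite !sum_O; reflexivity|rewrite !sum_Sn, <- IH; reflexivity]. }
assert (HI : forall n, Im (sum_n (G := C_NormedModule) a n) = sum_n (fun n => Im (a n)) n).
{ induction n as [|n IH]; [rewrite !sum_O; reflexivity|rewrite !sum_Sn, <- IH; reflexivity]. }
split.
- intros P HP. assert (Q := H (fun z => P (fst z))).
  assert (Q1 : locally (T := C_NormedModule) l (fun z : C => P (fst z))).
  { destruct HP as [e He]. exists e. intros y Hy. apply He. apply Hy. }
  specialize (Q Q1). destruct Q as [N HN]. exists N. intros n Hn. rewrite <- HR. exact (HN n Hn).
- intros P HP. assert (Q := H (fun z => P (snd z))).
  assert (Q1 : locally (T := C_NormedModule) l (fun z : C => P (snd z))).
  { destruct HP as [e He]. exists e. intros y Hy. apply He. apply Hy. }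
  specialize (Q Q1). destruct Q as [N HN]. exists N. intros n Hn. rewrite <- HI. exact (HN n Hn).
Qed.

Lemma is_series_Cseries (a : nat -> C) (l : C) :
  is_series (K := C_AbsRing) (V := C_NormedModule) a l -> l = Cseries a.
Proof.
intros H. apply is_series_Re_Im in H. destruct H as [H1 H2].
unfold Cseries. rewrite (surjective_pairing l).
f_equal; symmetry; apply is_series_unique; assumption.
Qed.

Definition psum (c : nat -> C) (z : C) : C := Cseries (fun n => (c n * z ^ n)%C).
Definition cderiv (c : nat -> C) (n : nat) : C := (RtoC (INR (S n)) * c (S n))%C.
(** Using the moduli of the coefficients gives access to the theory of the
    radius of convergence of real power series. *)
Definition unit_radius (c : nat -> C) : Prop := Rbar_le 1 (CV_radius (fun n => Cmod (c n))).

Lemma unit_radius_cderiv (c : nat -> C) : unit_radius c -> unit_radius (cderiv c).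
Proof.
unfold unit_radius. intros H. rewrite <- CV_radius_derive in H.
rewrite (CV_radius_ext _ (PS_derive (fun n => Cmod (c n)))); [exact H|].
intros n. unfold cderiv, PS_derive. rewrite Cmod_mult, Cmod_R, Rabs_pos_eq by apply pos_INR. reflexivity.
Qed.

Lemma unit_radius_summable (c : nat -> C) (r : R) : unit_radius c -> 0 <= r < 1 ->
  ex_series (fun n => Cmod (c n) * r ^ n).
Proof.
intros H Hr.
apply (ex_series_ext (fun n => Rabs (Cmod (c n) * r ^ n))).
{ intros n. apply Rabs_pos_eq. apply Rmult_le_pos; [apply Cmod_ge_0|apply pow_le; lra]. }
apply CV_disk_inside. eapply Rbar_lt_le_trans; [|exact H]. simpl. rewrite Rabs_pos_eq; lra.
Qed.

Lemma psum_summable (c : nat -> C) (z : C) : unit_radius c -> in_disk z ->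
  ex_series (fun n => Cmod (c n * z ^ n)).
Proof.
intros H Hz. apply (ex_series_ext (fun n => Cmod (c n) * Cmod z ^ n)).
{ intros n. rewrite Cmod_mult, Cmod_pow. reflexivity. }
apply unit_radius_summable; [exact H|]. split; [apply Cmod_ge_0|exact Hz].
Qed.

(** With e_n the left-hand side before taking the modulus,
    e_(n+1) = w e_n + (n + 1) z^n (w - z)^2. *)
Lemma pow_taylor (n : nat) (z w : C) (r : R) : Cmod z <= r -> Cmod w <= r ->
  Cmod (w ^ S n - z ^ S n - (w - z) * (RtoC (INR (S n)) * z ^ n))
  <= INR (S n) * INR n * r ^ (n - 1) * Cmod (w - z) ^ 2.
Proof.
intros Hz Hw. assert (Hr : 0 <= r) by (eapply Rle_trans; [apply Cmod_ge_0|apply Hz]).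
induction n as [|n IH].
- replace (w ^ 1 - z ^ 1 - (w - z) * (INR 1 * z ^ 0))%C with (RtoC 0) by (simpl; ring).
  rewrite Cmod_0. simpl. lra.
- assert (E : (w ^ S (S n) - z ^ S (S n) - (w - z) * (RtoC (INR (S (S n))) * z ^ S n)
    = w * (w ^ S n - z ^ S n - (w - z) * (RtoC (INR (S n)) * z ^ n))
      + RtoC (INR (S n)) * z ^ n * (w - z) ^ 2)%C).
  { rewrite (S_INR (S n)), RtoC_plus. simpl (w ^ S (S n))%C. simpl (z ^ S (S n))%C. simpl (_ ^ 2)%C. simpl (_ ^ S n)%C. ring. }
  rewrite E. eapply Rle_trans; [apply Cmod_triangle|]. rewrite !Cmod_mult, !Cmod_pow, Cmod_R.
  rewrite (Rabs_pos_eq (INR (S n))) by apply pos_INR.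
  assert (P := pow_le _ 2 (Cmod_ge_0 (w - z))). assert (Q := pos_INR n). assert (Q' := S_INR n).
  assert (Q'' := S_INR (S n)).
  assert (T : Cmod z ^ n <= r ^ n) by (apply pow_incr; split; [apply Cmod_ge_0|exact Hz]).
  assert (T' : 0 <= Cmod z ^ n) by (apply pow_le, Cmod_ge_0).
  replace (S n - 1)%nat with n by lia.
  assert (A : Cmod w * Cmod (w ^ S n - z ^ S n - (w - z) * (INR (S n) * z ^ n)) <=
     INR (S n) * INR n * r ^ n * Cmod (w - z) ^ 2).
  { eapply Rle_trans; [apply Rmult_le_compat; [apply Cmod_ge_0|apply Cmod_ge_0|apply Hw|apply IH]|].
    destruct n as [|n]; [simpl; lra|]. replace (S n - 1)%nat with n by lia. simpl (r ^ S n). apply Req_le. ring. }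
  assert (B : INR (S n) * Cmod z ^ n * Cmod (w - z) ^ 2 <= INR (S n) * r ^ n * Cmod (w - z) ^ 2).
  { apply Rmult_le_compat_r; [exact P|]. apply Rmult_le_compat_l; [lra|exact T]. }
  eapply Rle_trans; [apply Rplus_le_compat; [apply A|apply B]|].
  rewrite Q''. 
  replace (INR (S n) * INR n * r ^ n * Cmod (w - z) ^ 2 + INR (S n) * r ^ n * Cmod (w - z) ^ 2)
   with ((INR n + 1) * (INR (S n) * r ^ n * Cmod (w - z) ^ 2)) by ring.
  replace ((INR (S n) + 1) * INR (S n) * r ^ n * Cmod (w - z) ^ 2)
   with ((INR (S n) + 1) * (INR (S n) * r ^ n * Cmod (w - z) ^ 2)) by ring.
  apply Rmult_le_compat_r; [|lra].
  apply Rmult_le_pos; [apply Rmult_le_pos; [lra|apply pow_le, Hr]|exact P].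
Qed.

(** The Taylor remainders of the monomials, summed, are at most |w - z|^2 times
    the series of the second derivative at a radius r between |z| and 1. *)
Lemma is_derive_psum (c : nat -> C) (z : C) : unit_radius c -> in_disk z ->
  is_derive_C (psum c) z (psum (cderiv c) z).
Proof.
intros Hc Hz. unfold in_disk in Hz.
assert (Hc1 := unit_radius_cderiv c Hc). assert (Hc2 := unit_radius_cderiv _ Hc1).
set (r := (1 + Cmod z) / 2).
assert (Hz0 := Cmod_ge_0 z).
assert (Hr : 0 <= r < 1) by (unfold r; lra).
(* The series of the second derivative, with absolute values, at radius r. *)
set (b := fun n => Cmod (cderiv (cderiv c) n) * r ^ n).
assert (Hb : ex_series b) by (apply unit_radius_summable; assumption).
assert (Hb0 : 0 <= Series b).
{ rewrite <- (Rmult_0_l (Series b)), <- Series_scal_l. apply Series_le; [|exact Hb].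
  intros n. assert (0 <= b n) by (apply Rmult_le_pos; [apply Cmod_ge_0|apply pow_le; lra]). lra. }
assert (Main : forall w, Cmod w <= r ->
  Cmod (psum c w - psum c z - (w - z) * psum (cderiv c) z) <= 2 * Series b * Cmod (w - z) ^ 2).
{ intros w Hw.
  assert (Hwd : in_disk w) by (unfold in_disk; lra).
  assert (Sw := psum_summable c w Hc Hwd). assert (Sz := psum_summable c z Hc Hz).
  assert (Sd := psum_summable _ z Hc1 Hz).
  assert (E : (psum c w - psum c z - (w - z) * psum (cderiv c) z =
    Cseries (fun n => c (S n) * (w ^ S n - z ^ S n - (w - z) * (RtoC (INR (S n)) * z ^ n)))%C)%C).
  { unfold psum. rewrite (Cseries_incr_1 (fun n => c n * w ^ n)%C Sw), (Cseries_incr_1 (fun n => c n * z ^ n)%C Sz).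
    rewrite <- Cseries_scal by exact Sd.
    apply (ex_series_incr_1 (V := R_NormedModule) (fun n => Cmod (c n * w ^ n))) in Sw.
    apply (ex_series_incr_1 (V := R_NormedModule) (fun n => Cmod (c n * z ^ n))) in Sz.
    transitivity (Cseries (fun n => c (S n) * w ^ S n) - Cseries (fun n => c (S n) * z ^ S n)
       - Cseries (fun n => (w - z) * (cderiv c n * z ^ n)))%C; [simpl; ring|].
    rewrite <- Cseries_minus by assumption.
    rewrite <- Cseries_minus.
    - apply Cseries_ext. intros n. unfold cderiv. ring.
    - apply (ex_series_le (V := R_CompleteNormedModule) _
        (fun n => Cmod (c (S n) * w ^ S n) + Cmod (c (S n) * z ^ S n))).
      + intros n. change (Rabs (Cmod (c (S n) * w ^ S n - c (S n) * z ^ S n)) <=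
          Cmod (c (S n) * w ^ S n) + Cmod (c (S n) * z ^ S n)).
        rewrite Rabs_pos_eq by apply Cmod_ge_0. unfold Cminus.
        eapply Rle_trans; [apply Cmod_triangle|]. rewrite Cmod_opp. lra.
      + apply (ex_series_plus (V := R_NormedModule)); assumption.
    - apply (ex_series_ext (fun n => Cmod (w - z) * Cmod (cderiv c n * z ^ n))).
      { intros n. rewrite (Cmod_mult (w - z)). reflexivity. }
      apply (ex_series_scal (V := R_NormedModule)). exact Sd. }
  rewrite E.
  assert (Hzr : Cmod z <= r) by (unfold r; lra).
  set (B := fun n => INR (S n) * INR n * r ^ (n - 1) * Cmod (c (S n)) * Cmod (w - z) ^ 2).
  assert (HB1 : forall n, B (S n) = Cmod (w - z) ^ 2 * b n).
  { intros n. unfold B, b, cderiv. rewrite !Cmod_mult, !Cmod_R, !Rabs_pos_eq by apply pos_INR.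
    replace (S n - 1)%nat with n by lia. ring. }
  assert (HB0 : B O = 0) by (unfold B; simpl; ring).
  assert (HB : ex_series B).
  { apply (ex_series_incr_1 (V := R_NormedModule) B).
    apply (ex_series_ext (fun n => Cmod (w - z) ^ 2 * b n)); [intros n; symmetry; apply HB1|].
    apply (ex_series_scal (V := R_NormedModule)). exact Hb. }
  eapply Rle_trans; [apply (Cseries_bound _ B); [|exact HB]|].
  - intros n. rewrite Cmod_mult. unfold B.
    eapply Rle_trans; [apply Rmult_le_compat_l; [apply Cmod_ge_0|apply (pow_taylor n z w r Hzr Hw)]|].
    apply Req_le. ring.
  - rewrite (Series_incr_1 B HB), HB0, (Series_ext _ _ HB1), Series_scal_l.
    apply Req_le. ring. }
apply is_derive_C_eps. intros eps Heps.
set (M := 2 * Series b) in *.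
exists (Rmin ((1 - Cmod z) / 2) (eps / (M + 1))).
assert (0 < eps / (M + 1)) by (apply Rdiv_lt_0_compat; unfold M; lra).
split; [apply Rmin_pos; lra|].
intros w Hw.
assert (Hw1 := Rlt_le_trans _ _ _ Hw (Rmin_l _ _)).
assert (Hw2 := Rlt_le_trans _ _ _ Hw (Rmin_r _ _)).
eapply Rle_trans; [apply Main|].
- replace w with ((w - z) + z)%C by ring. eapply Rle_trans; [apply Cmod_triangle|]. unfold r. lra.
- assert (P := Cmod_ge_0 (w - z)).
  apply (Rmult_lt_compat_r (M + 1)) in Hw2; [|unfold M; lra].
  replace (eps / (M + 1) * (M + 1)) with eps in Hw2 by (field; unfold M; lra).
  simpl. rewrite Rmult_1_r, <- Rmult_assoc. apply Rmult_le_compat_r; [exact P|]. nra.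
Qed.

(** The terms of a convergent series are bounded, so every r < 1 is at most the
    radius of convergence. *)
Lemma unit_radius_of_convergence (c : nat -> C) :
  (forall z, in_disk z -> exists l, is_series (K := C_AbsRing) (V := C_NormedModule)
      (fun n => (c n * z ^ n)%C) l) -> unit_radius c.
Proof.
intros H. unfold unit_radius.
destruct (CV_radius_bounded (fun n => Cmod (c n))) as [Hub _].
assert (L : forall r, 0 < r < 1 -> Rbar_le r (CV_radius (fun n => Cmod (c n)))).
{ intros r Hr. apply Hub.
  destruct (H r) as [l Hl]. { unfold in_disk. rewrite Cmod_R, Rabs_pos_eq; lra. }
  apply is_series_Re_Im in Hl. destruct Hl as [H1 H2].
  assert (B1 := ex_series_lim_0 _ (ex_intro _ _ H1)). assert (B2 := ex_series_lim_0 _ (ex_intro _ _ H2)).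
  apply is_lim_seq_Reals in B1. apply is_lim_seq_Reals in B2.
  destruct (maj_by_pos _ (exist _ 0 B1)) as [M1 [_ HM1]].
  destruct (maj_by_pos _ (exist _ 0 B2)) as [M2 [_ HM2]].
  exists (M1 + M2). intros n.
  rewrite Rabs_pos_eq by (apply Rmult_le_pos; [apply Cmod_ge_0|apply pow_le; lra]).
  replace (Cmod (c n) * r ^ n) with (Cmod (c n * r ^ n)%C)
    by (rewrite Cmod_mult, Cmod_pow, Cmod_R, (Rabs_pos_eq r) by lra; reflexivity).
  rewrite (surjective_pairing (c n * RtoC r ^ n)%C).
  eapply Rle_trans; [apply Cmod_le_abs|].
  apply Rplus_le_compat; [apply HM1|apply HM2]. }
(* A finite radius x < 1 contradicts L at the midpoint of x and 1; the maximum with 0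
   keeps that midpoint positive. *)
destruct (CV_radius (fun n => Cmod (c n))) as [x| |]; simpl in *.
- apply Rnot_lt_le. intros Hlt.
  assert (A := L (/2)). assert (B := L ((1 + Rmax x 0) / 2)).
  unfold Rmax in B. destruct (Rle_dec x 0); lra.
- exact I.
- apply (L (/ 2)). lra.
Qed.

(** This is what makes the iterated derivatives of h and g genuine, and it
    identifies the first coefficient with the derivative at 0. *)
Lemma has_expansion_derive (h : C -> C) (a : nat -> C) : has_expansion h a ->
  exists h1 h2 : C -> C, h1 0%C = a 1%nat /\
    forall z, in_disk z -> is_derive_C h z (h1 z) /\ is_derive_C h1 z (h2 z).
Proof.
intros H.
set (c := fun n => match n with O => RtoC 0 | S _ => a n end).
assert (Hs : forall z, in_disk z -> is_series (K := C_AbsRing) (V := C_NormedModule) (fun n => (c n * z ^ n)%C) (h z)).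
{ intros z Hz.
  assert (A := is_series_decr_1 (K := C_AbsRing) (V := C_NormedModule) (fun n => (c n * z ^ n)%C) (h z)).
  apply A. clear A. cbv beta.
  assert (E : @plus C_NormedModule (h z) (opp (c O * z ^ O)%C) = h z)
    by (change ((h z + - (0 * z ^ 0))%C = h z); ring).
  exact (eq_ind_r (fun q => is_series (K := C_AbsRing) (V := C_NormedModule)
     (fun n : nat => (a (S n) * z ^ S n)%C) q) (H z Hz) E). }
assert (Hc : unit_radius c) by (apply unit_radius_of_convergence; intros z Hz; exists (h z); apply Hs, Hz).
assert (Hc1 := unit_radius_cderiv c Hc).
exists (psum (cderiv c)), (psum (cderiv (cderiv c))). split.
- assert (Z0 : in_disk 0) by (unfold in_disk; rewrite Cmod_0; lra).
  unfold psum. rewrite Cseries_incr_1 by (apply psum_summable; assumption).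
  rewrite (Cseries_ext _ (fun n => RtoC 0 * RtoC 0)%C) by (intros n; simpl; ring).
  rewrite Cseries_scal.
  + unfold cderiv. simpl. ring.
  + exists 0. apply (is_series_ext (fun _ => 0)); [intros; rewrite Cmod_0; reflexivity|].
    assert (T : is_series (fun n : nat => 0 * (/ 2) ^ n) (0 * / (1 - / 2))).
    { apply (is_series_scal (V := R_NormedModule)). apply is_series_geom. rewrite Rabs_pos_eq; lra. }
    rewrite Rmult_0_l in T. revert T. apply is_series_ext. intros n; exact (Rmult_0_l _).
- intros z Hz. split; [|apply is_derive_psum; assumption].
  apply (is_derive_C_local (psum c)); [exact Hz| |apply is_derive_psum; assumption].
  intros w Hw. symmetry. apply is_series_Cseries, Hs, Hw.
Qed.

(** * Exponential, logarithm and powers of the Cayley map *)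

Lemma Cexp_plus (z w : C) : Cexp (z + w) = (Cexp z * Cexp w)%C.
Proof.
destruct z as [a b], w as [c d]. unfold Cexp; simpl. rewrite exp_plus, cos_plus, sin_plus.
apply injective_projections; simpl; ring.
Qed.

Lemma Cexp_0 : Cexp 0 = 1%C.
Proof. unfold Cexp; simpl. rewrite exp_0, cos_0, sin_0. apply injective_projections; simpl; ring. Qed.

Lemma Cmod_Cexp (z : C) : Cmod (Cexp z) = exp (Re z).
Proof.
assert (H := Cmod2_alt (Cexp z)). unfold Cexp in H at 2 3; simpl in H.
assert (E := sin2_cos2 (Im z)). unfold Rsqr in E.
assert (P := exp_pos (Re z)). assert (Q := Cmod_ge_0 (Cexp z)). unfold Re, Im in *.
apply Rsqr_inj; [exact Q|lra|]. unfold Rsqr. 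
replace (exp (fst z) * exp (fst z)) with (exp (fst z) * exp (fst z) * (sin (snd z) * sin (snd z) + cos (snd z) * cos (snd z))) by (rewrite E; ring).
lra.
Qed.

Lemma derivable_pt_lim_0_eps (f : R -> R) (l : R) : derivable_pt_lim f 0 l ->
  forall eps, 0 < eps -> exists delta, 0 < delta /\
  forall x, Rabs x < delta -> Rabs (f x - f 0 - x * l) <= eps * Rabs x.
Proof.
intros H eps Heps. destruct (H eps Heps) as [d Hd]. exists d. split; [apply cond_pos|].
intros x Hx. destruct (Req_dec x 0) as [->|N].
- rewrite Rabs_R0. replace (f 0 - f 0 - 0 * l) with 0 by ring. rewrite Rabs_R0. lra.
- specialize (Hd x N Hx). rewrite Rplus_0_l in Hd.
  replace (f x - f 0 - x * l) with (((f x - f 0) / x - l) * x) by (field; exact N).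
  rewrite Rabs_mult. apply Rmult_le_compat_r; [apply Rabs_pos|lra].
Qed.

Lemma Cexp_derive_0 : is_derive_C Cexp 0%C 1%C.
Proof.
apply is_derive_C_eps. intros eps Heps.
set (e := eps / 10). assert (He : 0 < e) by (unfold e; lra).
destruct (derivable_pt_lim_0_eps exp 1 derivable_pt_lim_exp_0 e He) as [d1 [Hd1 H1]].
assert (Dc := derivable_pt_lim_cos 0). rewrite sin_0, Ropp_0 in Dc.
destruct (derivable_pt_lim_0_eps cos 0 Dc e He) as [d2 [Hd2 H2]].
assert (Ds := derivable_pt_lim_sin 0). rewrite cos_0 in Ds.
destruct (derivable_pt_lim_0_eps sin 1 Ds e He) as [d3 [Hd3 H3]].
exists (Rmin 1 (Rmin (e / (1 + e)) (Rmin d1 (Rmin d2 d3)))).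
assert (0 < e / (1 + e)) by (apply Rdiv_lt_0_compat; lra).
split; [repeat apply Rmin_pos; lra|].
intros [x y] Hw. replace ((x, y) - 0)%C with ((x, y) : C) in * by (apply injective_projections; simpl; ring).
apply Rmin_Rgt_l in Hw. destruct Hw as [W1 Hw].
apply Rmin_Rgt_l in Hw. destruct Hw as [W0 Hw].
apply Rmin_Rgt_l in Hw. destruct Hw as [W2 Hw].
apply Rmin_Rgt_l in Hw. destruct Hw as [W3 W4].
set (m := Cmod (x, y)) in *.
assert (Hx : Rabs x <= m) by (eapply Rle_trans; [|apply (Rmax_Cmod (x, y))]; apply Rmax_l).
assert (Hy : Rabs y <= m) by (eapply Rle_trans; [|apply (Rmax_Cmod (x, y))]; apply Rmax_r).
assert (A1 := H1 x ltac:(lra)). assert (A2 := H2 y ltac:(lra)). assert (A3 := H3 y ltac:(lra)).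
rewrite exp_0 in A1. rewrite cos_0 in A2. rewrite sin_0 in A3.
assert (Hx0 := Rabs_pos x). assert (Hy0 := Rabs_pos y).
assert (Hex : exp x <= 3).
{ eapply Rle_trans; [|apply exp_le_3]. apply Rlt_le, exp_increasing. assert (T := Rle_abs x). lra. }
assert (Hex0 := exp_pos x).
rewrite Cexp_0.
replace (Cexp (x, y) - 1 - (x, y) * 1)%C with
  ((exp x - 1 - x * 1) + exp x * (cos y - 1 - y * 0),
   exp x * (sin y - 0 - y * 1) + ((exp x - 1 - x * 1) + x) * y : R)
  by (unfold Cexp; apply injective_projections; simpl; ring).
eapply Rle_trans; [apply Cmod_le_abs|].
assert (B1 : Rabs ((exp x - 1 - x * 1) + exp x * (cos y - 1 - y * 0)) <= e * m + 3 * (e * m)).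
{ eapply Rle_trans; [apply Rabs_triang|]. rewrite Rabs_mult, (Rabs_pos_eq (exp x)) by lra.
  apply Rplus_le_compat; [nra|]. apply Rmult_le_compat; try lra; [apply Rabs_pos|nra]. }
assert (B2 : Rabs (exp x * (sin y - 0 - y * 1) + ((exp x - 1 - x * 1) + x) * y) <= 3 * (e * m) + e * m).
{ eapply Rle_trans; [apply Rabs_triang|]. rewrite !Rabs_mult, (Rabs_pos_eq (exp x)) by lra.
  apply Rplus_le_compat. { apply Rmult_le_compat; try lra; [apply Rabs_pos|nra]. }
  apply Rmult_le_compat; [apply Rabs_pos|apply Rabs_pos| |exact Hy].
  eapply Rle_trans; [apply Rabs_triang|].
  assert (m * (1 + e) < e).
  { apply (Rmult_lt_compat_r (1 + e)) in W0; [|lra]. replace (e / (1 + e) * (1 + e)) with e in W0 by (field; lra). exact W0. }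
  nra. }
unfold e in *. assert (0 <= m) by apply Cmod_ge_0. nra.
Qed.

Lemma Cexp_derive (z : C) : is_derive_C Cexp z (Cexp z).
Proof.
apply is_derive_C_eps. intros eps Heps.
assert (P := exp_pos (Re z)).
destruct (proj1 (is_derive_C_eps _ _ _) Cexp_derive_0 (eps / exp (Re z))) as [d [Hd H]].
{ apply Rdiv_lt_0_compat; assumption. }
exists d. split; [exact Hd|]. intros w Hw.
specialize (H (w - z)%C). replace (w - z - 0)%C with (w - z)%C in H by ring. specialize (H Hw).
rewrite Cexp_0 in H.
replace (Cexp w) with (Cexp z * Cexp (w - z))%C by (rewrite <- Cexp_plus; f_equal; ring).
replace (Cexp z * Cexp (w - z) - Cexp z - (w - z) * Cexp z)%C with
  (Cexp z * (Cexp (w - z) - 1 - (w - z) * 1))%C by ring.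
rewrite Cmod_mult, Cmod_Cexp.
eapply Rle_trans; [apply Rmult_le_compat_l; [lra|apply H]|].
apply Req_le. field. lra.
Qed.

Lemma Cexp_Clog (u : C) : u <> 0%C -> Cexp (Clog u) = u.
Proof.
intros Hu. assert (Hm : 0 < Cmod u) by (apply Cmod_gt_0; exact Hu).
assert (Hre := re_le_Cmod u).
assert (B : -1 <= Re u / Cmod u <= 1).
{ apply Rabs_le_between. unfold Rdiv. rewrite Rabs_mult, Rabs_inv, (Rabs_pos_eq (Cmod u)) by lra.
  apply Rle_div_l; lra. }
assert (Q : 1 - (Re u / Cmod u)² = (Im u / Cmod u)²).
{ assert (E := Cmod2_alt u). unfold Rsqr.
  replace 1 with (Cmod u ^ 2 / Cmod u ^ 2) by (field; lra). rewrite E at 1. field. lra. }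
unfold Cexp, Clog, Carg; simpl. rewrite exp_ln by exact Hm.
destruct (Rle_dec 0 (Im u)) as [Hi|Hi].
- rewrite cos_acos, sin_acos, Q by exact B. rewrite sqrt_Rsqr by (apply Rmult_le_pos; [exact Hi|apply Rlt_le, Rinv_0_lt_compat, Hm]).
  apply injective_projections; simpl; unfold Re, Im; field; lra.
- rewrite cos_neg, sin_neg, cos_acos, sin_acos, Q by exact B.
  rewrite Rsqr_neg, sqrt_Rsqr.
  2:{ rewrite <- Rdiv_opp_l. apply Rmult_le_pos; [lra|apply Rlt_le, Rinv_0_lt_compat, Hm]. }
  apply injective_projections; simpl; unfold Re, Im; field; lra.
Qed.

(** On the right half plane this formula shows the continuity of the argument,
    which its definition by cases hides. *)
Lemma Carg_atan (u : C) : 0 < Re u -> Carg u = atan (Im u / Re u).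
Proof.
intros Hu. assert (Hre := re_le_Cmod u). rewrite Rabs_pos_eq in Hre by lra.
assert (Hm : 0 < Cmod u) by lra.
assert (E := Cmod2_alt u).
unfold Carg. rewrite acos_atan by (apply Rdiv_lt_0_compat; assumption).
assert (Q : 1 - (Re u / Cmod u)² = (Im u / Cmod u)²).
{ unfold Rsqr. replace 1 with (Cmod u ^ 2 / Cmod u ^ 2) by (field; lra). rewrite E at 1. field. lra. }
rewrite Q. destruct (Rle_dec 0 (Im u)) as [Hi|Hi].
- rewrite sqrt_Rsqr by (apply Rmult_le_pos; [exact Hi|apply Rlt_le, Rinv_0_lt_compat, Hm]).
  f_equal. field. lra.
- rewrite Rsqr_neg, sqrt_Rsqr.
  2:{ rewrite <- Rdiv_opp_l. apply Rmult_le_pos; [lra|apply Rlt_le, Rinv_0_lt_compat, Hm]. }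
  rewrite <- atan_opp. f_equal. field. lra.
Qed.

Lemma Clog_continuous (u : C) : 0 < Re u -> forall eps, 0 < eps ->
  exists delta, 0 < delta /\ forall w, Cmod (w - u) < delta -> Cmod (Clog w - Clog u) < eps.
Proof.
intros Hu eps Heps.
assert (Hre := re_le_Cmod u). rewrite Rabs_pos_eq in Hre by lra.
assert (He : 0 < eps / 2) by lra.
assert (C1 : continuity_2d_pt (fun x y => atan (y * / x)) (Re u) (Im u)).
{ apply (continuity_1d_2d_pt_comp atan (fun x y => y * / x)).
  - apply derivable_continuous_pt, derivable_pt_atan.
  - apply continuity_2d_pt_mult; [apply continuity_2d_pt_id2|].
    apply continuity_2d_pt_inv; [apply continuity_2d_pt_id1|]. lra. }
destruct (C1 (mkposreal _ He)) as [d1 H1]. simpl in H1.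
destruct (ln_continue (Cmod u) ltac:(lra) (eps / 2) He) as [d2 [Hd2 H2]].
exists (Rmin d1 (Rmin d2 (Re u))). split.
{ repeat apply Rmin_pos; try lra. apply cond_pos. }
intros w Hw.
apply Rmin_Rgt_l in Hw. destruct Hw as [W1 Hw].
apply Rmin_Rgt_l in Hw. destruct Hw as [W2 W3].
assert (Hx : Rabs (Re w - Re u) <= Cmod (w - u)) by (apply (re_le_Cmod (w - u))).
assert (Hy : (Rabs (Im w - Im u) <= Cmod (w - u))%R).
{ apply (im_le_Cmod (w - u)). }
assert (Hw0 : 0 < Re w) by (apply Rabs_le_between in Hx; lra).
assert (Hwm := re_le_Cmod w). rewrite Rabs_pos_eq in Hwm by lra.
replace (Clog w - Clog u)%C with (((ln (Cmod w) - ln (Cmod u))%R, (Carg w - Carg u)%R) : C) by reflexivity.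
eapply Rle_lt_trans; [apply Cmod_le_abs|].
rewrite !Carg_atan by assumption.
assert (A := H1 (Re w) (Im w) ltac:(lra) ltac:(lra)).
assert (B : Rabs (ln (Cmod w) - ln (Cmod u)) < eps / 2).
{ destruct (Req_dec (Cmod w) (Cmod u)) as [E|N].
  - rewrite E, Rminus_diag, Rabs_R0. exact He.
  - apply H2. split; [split; [exact (Rlt_le_trans _ _ _ Hw0 Hwm)|auto]|].
    apply Rle_lt_trans with (2 := W2). apply Rabs_Cmod_minus. }
unfold Rdiv in *. lra.
Qed.

(** The logarithm is a continuous right inverse of the exponential, whose
    derivative at Clog u is u; the derivative of an inverse is the inverse of
    the derivative. *)
Lemma Clog_derive (u : C) : 0 < Re u -> is_derive_C Clog u (/ u)%C.
Proof.
intros Hu. assert (Hre := re_le_Cmod u). rewrite Rabs_pos_eq in Hre by lra.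
assert (Hm : 0 < Cmod u) by lra.
assert (Hu0 : u <> 0%C) by (apply Cmod_gt_0; exact Hm).
apply is_derive_C_eps. intros eps Heps.
assert (HE := Cexp_derive (Clog u)). rewrite Cexp_Clog in HE by exact Hu0.
(* The first bound on e makes |Clog w - Clog u| at most 2 |w - u| / |u|; the second
   turns this into the required error. *)
set (e := Rmin (Cmod u / 2) (eps * Cmod u * Cmod u / 2)).
assert (He : 0 < e).
{ unfold e. apply Rmin_pos; [lra|]. assert (0 < eps * Cmod u * Cmod u) by (repeat apply Rmult_lt_0_compat; lra). lra. }
destruct (proj1 (is_derive_C_eps _ _ _) HE e He) as [d [Hd H]].
destruct (Clog_continuous u Hu d Hd) as [d' [Hd' H']].
exists (Rmin d' (Re u)). split; [apply Rmin_pos; assumption|].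
intros w Hw. apply Rmin_Rgt_l in Hw. destruct Hw as [W1 W2].
assert (Hx : Rabs (Re w - Re u) <= Cmod (w - u)) by (apply (re_le_Cmod (w - u))).
assert (Hw0 : 0 < Re w) by (apply Rabs_le_between in Hx; lra).
assert (Hwn : w <> 0%C).
{ intros ->. simpl in Hw0. lra. }
specialize (H (Clog w) (H' w W1)). rewrite !Cexp_Clog in H by assumption.
set (D := (Clog w - Clog u)%C) in *. set (m := Cmod (w - u)) in *.
assert (E1 : Cmod D * Cmod u <= m + e * Cmod D).
{ rewrite <- Cmod_mult. replace (D * u)%C with ((w - u) - (w - u - D * u))%C by ring.
  unfold Cminus at 1. eapply Rle_trans; [apply Cmod_triangle|]. rewrite Cmod_opp.
  apply Rplus_le_compat_l. exact H. }
assert (HD := Cmod_ge_0 D). assert (e1 : e <= Cmod u / 2) by apply Rmin_l.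
assert (e2 : e <= eps * Cmod u * Cmod u / 2) by apply Rmin_r.
assert (E2 : Cmod D * Cmod u <= 2 * m) by nra.
replace (D - (w - u) * / u)%C with (- ((w - u - D * u) / u))%C by (field; exact Hu0).
rewrite Cmod_opp, Cmod_div by exact Hu0.
apply Rle_div_l; [exact Hm|]. eapply Rle_trans; [apply H|].
apply Rle_trans with (eps * Cmod u * Cmod u / 2 * Cmod D); [apply Rmult_le_compat_r; assumption|].
assert (0 <= eps * Cmod u) by (apply Rmult_le_pos; lra).
assert (eps * Cmod u * (Cmod D * Cmod u) <= eps * Cmod u * (2 * m)) by (apply Rmult_le_compat_l; assumption).
lra.
Qed.

(** The Cayley map (1 + z) / (1 - z) sends the disk into the right half plane,
    where the principal power is analytic. *)
Definition cayley_power (lambda : R) (z : C) : C := Cpower ((1 + z) / (1 - z)) lambda.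

Lemma disk_1_minus (z : C) : in_disk z -> (1 - z)%C <> 0%C.
Proof.
intros Hz E. assert (z = 1)%C by (replace z with (1 - (1 - z))%C by ring; rewrite E; ring).
unfold in_disk in Hz. rewrite H, Cmod_1 in Hz. lra.
Qed.
Lemma disk_1_plus (z : C) : in_disk z -> (1 + z)%C <> 0%C.
Proof.
intros Hz E. assert (z = - (1))%C by (replace z with ((1 + z) - 1)%C by ring; rewrite E; ring).
unfold in_disk in Hz. rewrite H, Cmod_m1 in Hz. lra.
Qed.

Lemma disk_half_plane (z : C) : in_disk z -> 0 < Re ((1 + z) / (1 - z)).
Proof.
intros Hz.
assert (H1 : 0 < Cmod (1 - z)) by (apply Cmod_gt_0, disk_1_minus, Hz).
assert (E := Cmod2_alt (1 - z)). assert (E' := Cmod2_alt z).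
assert (Q := pow_lt _ 2 H1). rewrite E in Q. unfold in_disk in Hz. assert (P := Cmod_ge_0 z).
assert (Cmod z ^ 2 < 1) by nra. rewrite E' in H.
destruct z as [x y]. simpl in *. 
replace ((1 + x) * ((1 + - x) / ((1 + - x) * ((1 + - x) * 1) + (0 + - y) * ((0 + - y) * 1))) -
  (0 + y) * (- (0 + - y) / ((1 + - x) * ((1 + - x) * 1) + (0 + - y) * ((0 + - y) * 1)))) with
 ((1 - (x * (x * 1) + y * (y * 1))) / ((1 + - x) * ((1 + - x) * 1) + (0 + - y) * ((0 + - y) * 1))).
- apply Rdiv_lt_0_compat; lra.
- field. lra.
Qed.

(** The logarithm of the Cayley map has derivative 2 / (1 - z^2). *)
Lemma cayley_power_derive (lambda : R) (z : C) : in_disk z ->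
  is_derive_C (cayley_power lambda) z (RtoC (2 * lambda) * cayley_power lambda z / (1 - z * z))%C.
Proof.
intros Hz. assert (N1 := disk_1_minus z Hz). assert (N2 := disk_1_plus z Hz).
assert (D1 : is_derive_C (fun w => (1 + w) / (1 - w))%C z (2 / ((1 - z) * (1 - z)))%C).
{ replace (2 / ((1 - z) * (1 - z)))%C with ((0 + 1) * / (1 - z) + (1 + z) * ((0 + (-(1)) * 1) * - / ((1 - z) * (1 - z))))%C by (field; exact N1).
  apply (is_derive_C_mult (fun w => 1 + w)%C (fun w => / (1 - w))%C).
  - apply is_derive_C_plus; [apply is_derive_C_const|apply is_derive_C_id].
  - apply (is_derive_C_comp Cinv (fun w => 1 - w)%C); [apply Cinv_derive, N1|].
    apply (is_derive_ext (fun w : C => (1 + (-(1)) * w)%C : C_NormedModule)).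
    { intros w. change ((1 + - (1) * w)%C = (1 - w)%C). ring. }
    apply is_derive_C_plus; [apply is_derive_C_const|].
    replace (- (1) * 1)%C with (0 * z + - (1) * 1)%C by ring.
    apply (is_derive_C_mult (fun _ => - (1))%C (fun w => w)); [apply is_derive_C_const|apply is_derive_C_id]. }
assert (D2 := is_derive_C_comp Clog _ z _ _ (Clog_derive _ (disk_half_plane z Hz)) D1).
assert (D3 := is_derive_C_mult (fun _ => RtoC lambda) _ z _ _ (is_derive_C_const _ _) D2).
assert (D4 := is_derive_C_comp Cexp _ z _ _ (Cexp_derive _) D3).
unfold cayley_power, Cpower.
apply (is_derive_C_eq _ _ _ _ D4).
rewrite RtoC_mult. set (X := Cexp _). field. repeat split; try assumption.
- replace (1 - z * z)%C with ((1 - z) * (1 + z))%C by ring. apply Cmult_neq_0; assumption.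
Qed.

(** * The complex derivative of H *)

Lemma segment_in_ball (r t : R) (z w : C) : Cmod z <= r -> Cmod w <= r -> 0 <= t <= 1 ->
  Cmod (z + RtoC t * (w - z)) <= r.
Proof.
intros Hz Hw Ht. replace (z + t * (w - z))%C with (RtoC (1 - t) * z + RtoC t * w)%C
  by (rewrite RtoC_minus; ring).
eapply Rle_trans; [apply Cmod_triangle|].
rewrite !Cmod_mult, !Cmod_R, !Rabs_pos_eq by lra. nra.
Qed.

Lemma segment_dist (t : R) (z w : C) : 0 <= t <= 1 ->
  Cmod (z + RtoC t * (w - z) - z) <= Cmod (w - z).
Proof.
intros Ht. replace (z + t * (w - z) - z)%C with (RtoC t * (w - z))%C by ring.
rewrite Cmod_mult, Cmod_R, Rabs_pos_eq by lra. assert (H := Cmod_ge_0 (w - z)). nra.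
Qed.

(** Apply the mean value inequality to u |-> f u - df z * u, whose derivative
    is bounded by the same inequality for df. The constant is not the sharp
    B / 2. *)
Lemma taylor_C (f df ddf : C -> C) (z w : C) (r B : R) :
  Cmod z <= r -> Cmod w <= r ->
  (forall u, Cmod u <= r -> is_derive_C f u (df u)) ->
  (forall u, Cmod u <= r -> is_derive_C df u (ddf u)) ->
  (forall u, Cmod u <= r -> Cmod (ddf u) <= B) ->
  Cmod (f w - f z - (w - z) * df z) <= B * Cmod (w - z) ^ 2.
Proof.
intros Hz Hw H1 H2 HB.
assert (B0 : 0 <= B) by (eapply Rle_trans; [apply Cmod_ge_0|apply (HB z Hz)]).
assert (M : Cmod ((f w + (- df z) * w) - (f z + (- df z) * z)) <= B * Cmod (w - z) * Cmod (w - z)).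
{ apply (mean_value_C (fun u => f u + (- df z) * u)%C (fun u => df u + - df z)%C).
  - intros t Ht. assert (S := segment_in_ball r t z w Hz Hw Ht).
    apply is_derive_C_plus; [apply H1, S|].
    apply (is_derive_C_eq _ _ (- df z * 1)%C); [|ring].
    apply (is_derive_C_scal (- df z)%C (fun u => u)), is_derive_C_id.
  - intros t Ht. assert (S := segment_in_ball r t z w Hz Hw Ht).
    set (u := (z + t * (w - z))%C) in *.
    apply Rle_trans with (B * Cmod (u - z)).
    + apply (mean_value_C df ddf); intros s Hs; assert (S' := segment_in_ball r s z u Hz S Hs).
      * apply H2, S'.
      * apply HB, S'.
    + apply Rmult_le_compat_l; [exact B0|]. apply segment_dist, Ht. }
replace (f w - f z - (w - z) * df z)%C with ((f w + (- df z) * w) - (f z + (- df z) * z))%C by ring.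
eapply Rle_trans; [apply M|]. apply Req_le. ring.
Qed.

Definition cayley_power_d1 (lambda : R) (z : C) : C :=
  (RtoC (2 * lambda) * cayley_power lambda z / (1 - z * z))%C.
Definition cayley_power_d2 (lambda : R) (z : C) : C :=
  (RtoC (4 * lambda) * (RtoC lambda + z) * cayley_power lambda z / ((1 - z * z) * (1 - z * z)))%C.

Lemma disk_1_minus_sq (z : C) : in_disk z -> (1 - z * z)%C <> 0%C.
Proof.
intros Hz. replace (1 - z * z)%C with ((1 - z) * (1 + z))%C by ring.
apply Cmult_neq_0; [apply disk_1_minus|apply disk_1_plus]; exact Hz.
Qed.

Lemma cayley_power_derive_2 (lambda : R) (z : C) : in_disk z ->
  is_derive_C (cayley_power_d1 lambda) z (cayley_power_d2 lambda z).
Proof.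
intros Hz. assert (N := disk_1_minus_sq z Hz).
assert (D := cayley_power_derive lambda z Hz).
assert (D0 := is_derive_C_scal (RtoC (2 * lambda)) _ _ _ D).
assert (D1 : is_derive_C (fun w => 1 + (-(1)) * (w * w))%C z (0 + (-(1)) * (1 * z + z * 1))%C).
{ apply is_derive_C_plus; [apply is_derive_C_const|]. apply is_derive_C_scal.
  apply (is_derive_C_mult (fun w => w) (fun w => w)); apply is_derive_C_id. }
assert (N' : (1 + (-(1)) * (z * z))%C <> 0%C) by (replace (1 + - (1) * (z * z))%C with (1 - z * z)%C by ring; exact N).
assert (D2 := is_derive_C_comp Cinv _ z _ _ (Cinv_derive _ N') D1).
assert (D3 := is_derive_C_mult _ _ z _ _ D0 D2).
apply (is_derive_C_ext (fun w => RtoC (2 * lambda) * cayley_power lambda w * / (1 + (-(1)) * (w * w)))%C).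
{ intros w. unfold cayley_power_d1, Cdiv. f_equal. f_equal. ring. }
apply (is_derive_C_eq _ _ _ _ D3). unfold cayley_power_d2. rewrite !RtoC_mult. field.
exact N.
Qed.

Lemma Cmod_Cpower_R (u : C) (lambda : R) : Cmod (Cpower u (RtoC lambda)) = Rpower (Cmod u) lambda.
Proof.
unfold Cpower. rewrite Cmod_Cexp. unfold Rpower, Clog. f_equal. simpl. ring.
Qed.

Lemma cayley_power_neq_0 (lambda : R) (z : C) : cayley_power lambda z <> 0%C.
Proof. apply Cmod_gt_0. unfold cayley_power. rewrite Cmod_Cpower_R. apply exp_pos. Qed.

Lemma Rpower_le_compat_l (a b c : R) : 0 < a -> a <= b -> 0 <= c -> Rpower a c <= Rpower b c.
Proof. intros Ha Hab Hc. apply Rle_Rpower_l; [exact Hc|lra]. Qed.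

(** Crude bounds, uniform on the disk of radius r, where 1 - r <= |1 - z| and
    1 - r <= |1 - z^2|. *)
Section Bounds.
Variables (lambda r : R).
Hypotheses (Hl : 0 <= lambda) (Hr : 0 <= r < 1).
Let A := Rpower (2 / (1 - r)) lambda.

Lemma cayley_power_bound (z : C) : Cmod z <= r -> Cmod (cayley_power lambda z) <= A.
Proof.
intros Hz. assert (Hd : in_disk z) by (unfold in_disk; lra).
unfold cayley_power, A. rewrite Cmod_Cpower_R.
assert (N1 := disk_1_minus z Hd). assert (N2 := disk_1_plus z Hd).
rewrite Cmod_div by exact N1. apply Cmod_gt_0 in N1. apply Cmod_gt_0 in N2.
apply Rpower_le_compat_l; [apply Rdiv_lt_0_compat; assumption| |exact Hl].
assert (L : 1 - r <= Cmod (1 - z)).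
{ assert (T := Cmod_triangle (1 - z) z). replace (1 - z + z)%C with (RtoC 1) in T by ring. rewrite Cmod_1 in T. lra. }
assert (U : Cmod (1 + z) <= 2).
{ eapply Rle_trans; [apply Cmod_triangle|]. rewrite Cmod_1. lra. }
unfold Rdiv. apply Rmult_le_compat; [apply Cmod_ge_0|apply Rlt_le, Rinv_0_lt_compat; lra|exact U|].
apply Rinv_le_contravar; lra.
Qed.

Lemma one_minus_sq_bound (z : C) : Cmod z <= r -> 1 - r <= Cmod (1 - z * z).
Proof.
intros Hz. assert (T := Cmod_triangle (1 - z * z) (z * z)).
replace (1 - z * z + z * z)%C with (RtoC 1) in T by ring. rewrite Cmod_1, Cmod_mult in T.
assert (P := Cmod_ge_0 z). nra.
Qed.

Lemma cayley_power_d1_bound (z : C) : Cmod z <= r ->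
  Cmod (cayley_power_d1 lambda z) <= 2 * lambda * A / (1 - r).
Proof.
intros Hz. assert (Hd : in_disk z) by (unfold in_disk; lra).
assert (N := disk_1_minus_sq z Hd). unfold cayley_power_d1.
rewrite Cmod_div by exact N. rewrite Cmod_mult, Cmod_R, Rabs_pos_eq by lra.
assert (K := cayley_power_bound z Hz). assert (L := one_minus_sq_bound z Hz).
unfold Rdiv. apply Rmult_le_compat.
- apply Rmult_le_pos; [lra|apply Cmod_ge_0].
- apply Rlt_le, Rinv_0_lt_compat. lra.
- apply Rmult_le_compat_l; lra.
- apply Rinv_le_contravar; lra.
Qed.

Lemma cayley_power_d2_bound (z : C) : Cmod z <= r ->
  Cmod (cayley_power_d2 lambda z) <= 4 * lambda * (lambda + 1) * A / ((1 - r) * (1 - r)).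
Proof.
intros Hz. assert (Hd : in_disk z) by (unfold in_disk; lra).
assert (N := disk_1_minus_sq z Hd). unfold cayley_power_d2.
rewrite Cmod_div by (apply Cmult_neq_0; exact N).
rewrite !Cmod_mult, Cmod_R, Rabs_pos_eq by lra.
assert (K := cayley_power_bound z Hz). assert (L := one_minus_sq_bound z Hz).
assert (T := Cmod_triangle lambda z). rewrite Cmod_R, Rabs_pos_eq in T by lra.
unfold Rdiv. apply Rmult_le_compat.
- repeat apply Rmult_le_pos; try lra; apply Cmod_ge_0.
- apply Rlt_le, Rinv_0_lt_compat. nra.
- apply Rmult_le_compat; [apply Rmult_le_pos; [lra|apply Cmod_ge_0]|apply Cmod_ge_0| |exact K].
  apply Rmult_le_compat_l; lra.
- apply Rinv_le_contravar; [nra|]. apply Rmult_le_compat; lra.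
Qed.
End Bounds.

Lemma scaled_in_ball (s r : R) (z : C) : 0 <= s <= 1 -> Cmod z <= r -> Cmod (RtoC s * z) <= r.
Proof. intros Hs Hz. rewrite Cmod_mult, Cmod_R, Rabs_pos_eq by lra. assert (P := Cmod_ge_0 z). nra. Qed.

Lemma is_derive_C_dilate (f : C -> C) (c z l : C) : is_derive_C f (c * z)%C l ->
  is_derive_C (fun w => f (c * w)%C) z (c * l)%C.
Proof.
intros H. apply (is_derive_C_comp f (fun w => c * w)%C); [exact H|].
apply (is_derive_C_eq _ _ (c * 1)%C); [|ring]. apply (is_derive_C_scal c (fun w => w)), is_derive_C_id.
Qed.

Definition Hfun_integrand (lambda : R) (s z : C) : C := (z * cayley_power lambda (s * z))%C.
(** This is both the derivative in z of z k(s z) and the derivative in s of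
    s k(s z): the latter is why its integral over [0, 1] is k(z). *)
Definition Hfun_integrand_d1 (lambda : R) (s z : C) : C :=
  (cayley_power lambda (s * z) + s * z * cayley_power_d1 lambda (s * z))%C.
Definition Hfun_integrand_d2 (lambda : R) (s z : C) : C :=
  (2 * s * cayley_power_d1 lambda (s * z) + s * s * z * cayley_power_d2 lambda (s * z))%C.

Lemma Hfun_integrand_derive (lambda : R) (s z : C) : in_disk (s * z) ->
  is_derive_C (Hfun_integrand lambda s) z (Hfun_integrand_d1 lambda s z) /\
  is_derive_C (Hfun_integrand_d1 lambda s) z (Hfun_integrand_d2 lambda s z).
Proof.
intros Hz.
assert (K0 := is_derive_C_dilate _ s z _ (cayley_power_derive lambda _ Hz)).
assert (K1 := is_derive_C_dilate _ s z _ (cayley_power_derive_2 lambda _ Hz)).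
split.
- apply (is_derive_C_eq _ _ _ _ (is_derive_C_mult (fun w => w) _ z _ _ (is_derive_C_id z) K0)).
  unfold Hfun_integrand_d1, cayley_power_d1. ring.
- assert (S : is_derive_C (fun w => s * w)%C z s).
  { apply (is_derive_C_eq _ _ (s * 1)%C); [|ring]. apply (is_derive_C_scal s (fun w => w)), is_derive_C_id. }
  apply (is_derive_C_eq _ _ _ _ (is_derive_C_plus _ _ z _ _ K0 (is_derive_C_mult _ _ z _ _ S K1))).
  unfold Hfun_integrand_d2, cayley_power_d1. ring.
Qed.

Lemma Hfun_integrand_d2_bound (lambda r : R) : 0 <= lambda -> 0 <= r < 1 ->
  exists B, 0 <= B /\ forall (s : R) (z : C), 0 <= s <= 1 -> Cmod z <= r ->
    Cmod (Hfun_integrand_d2 lambda s z) <= B.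
Proof.
intros Hl Hr. set (A := Rpower (2 / (1 - r)) lambda).
set (B1 := 2 * lambda * A / (1 - r)). set (B2 := 4 * lambda * (lambda + 1) * A / ((1 - r) * (1 - r))).
assert (H1 := cayley_power_d1_bound lambda r Hl Hr). assert (H2 := cayley_power_d2_bound lambda r Hl Hr).
fold A in H1, H2. fold B1 in H1. fold B2 in H2.
assert (Z : Cmod 0 <= r) by (rewrite Cmod_0; lra).
assert (P1 : 0 <= B1) by (eapply Rle_trans; [apply Cmod_ge_0|apply (H1 0%C Z)]).
assert (P2 : 0 <= B2) by (eapply Rle_trans; [apply Cmod_ge_0|apply (H2 0%C Z)]).
exists (2 * B1 + B2). split; [lra|].
intros s z Hs Hz. assert (S := scaled_in_ball s r z Hs Hz). unfold Hfun_integrand_d2.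
eapply Rle_trans; [apply Cmod_triangle|]. rewrite !Cmod_mult, !Cmod_R, (Rabs_pos_eq s), (Rabs_pos_eq 2) by lra.
specialize (H1 _ S). specialize (H2 _ S).
assert (Q1 := Cmod_ge_0 (cayley_power_d1 lambda (s * z))). assert (Q2 := Cmod_ge_0 (cayley_power_d2 lambda (s * z))).
assert (Q := Cmod_ge_0 z).
apply Rplus_le_compat.
- apply Rmult_le_compat; nra.
- apply Rle_trans with (1 * B2); [|lra]. assert (0 <= s * s <= 1) by nra.
  apply Rmult_le_compat; try lra; [apply Rmult_le_pos; lra|nra].
Qed.

Lemma is_RInt_Hfun (lambda : R) (z : C) : in_disk z ->
  is_RInt (V := C_R_NormedModule) (fun s : R => Hfun_integrand lambda s z) 0 1 (Hfun lambda z).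
Proof.
intros Hz. apply (RInt_correct (V := C_R_CompleteNormedModule)).
apply (ex_RInt_continuous (V := C_R_CompleteNormedModule)).
intros s Hs. rewrite Rmin_left, Rmax_right in Hs by lra.
assert (D : in_disk (RtoC s * z)).
{ unfold in_disk in *. eapply Rle_lt_trans; [apply (scaled_in_ball s _ z Hs (Rle_refl _))|exact Hz]. }
assert (K := is_derive_C_scal z _ _ _ (is_derive_C_dilate _ z s _ (cayley_power_derive lambda (z * s)%C ltac:(rewrite Cmult_comm; exact D)))).
apply (is_derive_RC_continuous _ _ (1 * (z * (z * (RtoC (2 * lambda) * cayley_power lambda (z * s) / (1 - (z * s) * (z * s))))))%C).
assert (L := is_derive_RC_line (fun u => z * cayley_power lambda (z * u))%C 0 1 
  (z * (z * (RtoC (2 * lambda) * cayley_power lambda (z * s) / (1 - (z * s) * (z * s)))))%C s).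
replace (0 + s * 1)%C with (RtoC s) in L by ring.
specialize (L K). revert L. apply is_derive_ext. intros t. 
change ((z * cayley_power lambda (z * (0 + t * 1)) = z * cayley_power lambda (t * z))%C).
do 2 f_equal. ring.
Qed.

Lemma is_RInt_Hfun_d1 (lambda : R) (c z : C) : in_disk z ->
  is_RInt (V := C_R_NormedModule) (fun s : R => c * Hfun_integrand_d1 lambda s z)%C 0 1
   (c * cayley_power lambda z)%C.
Proof.
intros Hz.
assert (D : forall s, 0 <= s <= 1 -> in_disk (z * RtoC s)).
{ intros s Hs. rewrite Cmult_comm. unfold in_disk in *. eapply Rle_lt_trans; [apply (scaled_in_ball s _ z Hs (Rle_refl _))|exact Hz]. }
set (G := fun s : R => (c * (s * cayley_power lambda (s * z)))%C).
replace (c * cayley_power lambda z)%C with (minus (G := C_R_NormedModule) (G 1) (G 0)).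
2:{ change ((G 1 - G 0)%C = (c * cayley_power lambda z)%C). unfold G.
    replace (1 * z)%C with z by ring. ring. }
apply (is_RInt_derive (V := C_R_CompleteNormedModule) G).
- intros s Hs. rewrite Rmin_left, Rmax_right in Hs by lra.
  destruct (Hfun_integrand_derive lambda z s (D s Hs)) as [K _].
  apply (is_derive_C_scal c) in K.
  assert (L := is_derive_RC_line (fun u => c * Hfun_integrand lambda z u)%C 0 1 (c * Hfun_integrand_d1 lambda z s)%C s).
  replace (0 + s * 1)%C with (RtoC s) in L by ring. specialize (L K).
  replace (1 * (c * Hfun_integrand_d1 lambda z s))%C with (c * Hfun_integrand_d1 lambda s z)%C in L.
  2:{ unfold Hfun_integrand_d1. rewrite (Cmult_comm s z). ring. }
  revert L. apply is_derive_ext. intros t. unfold Hfun_integrand, G.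
  replace (0 + t * 1)%C with (RtoC t) by ring. rewrite (Cmult_comm z t). reflexivity.
- intros s Hs. rewrite Rmin_left, Rmax_right in Hs by lra.
  destruct (Hfun_integrand_derive lambda z s (D s Hs)) as [_ K].
  apply (is_derive_C_scal c) in K.
  assert (L := is_derive_RC_line (fun u => c * Hfun_integrand_d1 lambda z u)%C 0 1 (c * Hfun_integrand_d2 lambda z s)%C s).
  replace (0 + s * 1)%C with (RtoC s) in L by ring. specialize (L K).
  apply (is_derive_RC_continuous _ _ (1 * (c * Hfun_integrand_d2 lambda z s))%C).
  revert L. apply is_derive_ext. intros t. unfold Hfun_integrand_d1.
  replace (0 + t * 1)%C with (RtoC t) by ring. rewrite (Cmult_comm z t). reflexivity.
Qed.

(** Differentiation under the integral sign: the integrand satisfies a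
    second-order Taylor estimate in z, uniformly in s, and the integral of its
    derivative is k(z) by the fundamental theorem of calculus. *)
Lemma Hfun_derive (lambda : R) (z : C) : 0 <= lambda -> in_disk z ->
  is_derive_C (Hfun lambda) z (cayley_power lambda z).
Proof.
intros Hl Hz. unfold in_disk in Hz. assert (P := Cmod_ge_0 z).
set (r := (1 + Cmod z) / 2). assert (Hr : 0 <= r < 1) by (unfold r; lra).
destruct (Hfun_integrand_d2_bound lambda r Hl Hr) as [B [HB0 HB]].
apply is_derive_C_eps. intros eps Heps.
exists (Rmin ((1 - Cmod z) / 2) (eps / (B + 1))).
assert (0 < eps / (B + 1)) by (apply Rdiv_lt_0_compat; lra).
split; [apply Rmin_pos; lra|].
intros w Hw. apply Rmin_Rgt_l in Hw. destruct Hw as [W1 W2].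
assert (Hwr : Cmod w <= r).
{ replace w with ((w - z) + z)%C by ring. eapply Rle_trans; [apply Cmod_triangle|]. unfold r. lra. }
assert (Hzr : Cmod z <= r) by (unfold r; lra).
assert (I := is_RInt_minus (V := C_R_NormedModule) _ _ _ _ _ _
  (is_RInt_minus (V := C_R_NormedModule) _ _ _ _ _ _
   (is_RInt_Hfun lambda w ltac:(unfold in_disk; lra)) (is_RInt_Hfun lambda z Hz))
  (is_RInt_Hfun_d1 lambda (w - z)%C z Hz)).
assert (G : Cmod (Hfun lambda w - Hfun lambda z - (w - z) * cayley_power lambda z) <= (1 - 0) * (B * Cmod (w - z) ^ 2)).
{ rewrite Cmod_norm.
  refine (norm_RInt_le_const (V := C_R_NormedModule) _ 0 1 _ (B * Cmod (w - z) ^ 2) ltac:(lra) _ I).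
  intros s Hs.
  change (norm (V := C_R_NormedModule) (Hfun_integrand lambda s w - Hfun_integrand lambda s z - (w - z) * Hfun_integrand_d1 lambda s z)%C <= B * Cmod (w - z) ^ 2).
  rewrite <- Cmod_norm.
  assert (D : forall u, Cmod u <= r -> in_disk (RtoC s * u)).
  { intros u Hu. unfold in_disk. eapply Rle_lt_trans; [apply (scaled_in_ball s r u Hs Hu)|lra]. }
  apply (taylor_C _ _ (Hfun_integrand_d2 lambda s) z w r); try assumption.
  - intros u Hu. apply Hfun_integrand_derive, D, Hu.
  - intros u Hu. apply Hfun_integrand_derive, D, Hu.
  - intros u Hu. apply HB; assumption. }
eapply Rle_trans; [apply G|].
assert (Q := Cmod_ge_0 (w - z)).
apply (Rmult_lt_compat_r (B + 1)) in W2; [|lra].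
replace (eps / (B + 1) * (B + 1)) with eps in W2 by (field; lra).
simpl. nra.
Qed.

(** * Distortion and growth from a bounded pre-Schwarzian norm *)

Lemma is_derive_RC_Re (G : R -> C) (t : R) (l : C) :
  is_derive_RC G t l -> is_derive (fun s => Re (G s)) t (Re l).
Proof.
intros H. assert (K := is_derive_Re_mult 1 G t l H).
replace (1 * l)%C with l in K by ring. revert K. apply is_derive_ext. intros s.
f_equal. ring.
Qed.

Lemma is_derive_RC_Im (G : R -> C) (t : R) (l : C) :
  is_derive_RC G t l -> is_derive (fun s => Im (G s)) t (Im l).
Proof.
intros H. assert (K := is_derive_Re_mult (- Ci) G t l H).
replace (Re (- Ci * l)) with (Im l) in K by (unfold Re, Im; simpl; ring). revert K. apply is_derive_ext. intros s.
unfold Re, Im; simpl; ring.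
Qed.

Lemma is_derive_RC_Cmod_sq (G : R -> C) (t : R) (l : C) :
  is_derive_RC G t l -> is_derive (fun s => Cmod (G s) ^ 2) t (2 * Re (Cconj (G t) * l)).
Proof.
intros H.
assert (H1 := is_derive_RC_Re G t l H). assert (H2 := is_derive_RC_Im G t l H).
apply (is_derive_ext (fun s => Re (G s) * Re (G s) + Im (G s) * Im (G s))).
{ intros s. rewrite Cmod2_alt. simpl. change (Re (G s) * Re (G s) + Im (G s) * Im (G s) = Re (G s) * (Re (G s) * 1) + Im (G s) * (Im (G s) * 1)). ring. }
assert (M1 := is_derive_mult _ _ _ _ _ H1 H1 Rmult_comm).
assert (M2 := is_derive_mult _ _ _ _ _ H2 H2 Rmult_comm).
assert (S := is_derive_plus _ _ _ _ _ M1 M2).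
replace (2 * Re (Cconj (G t) * l)) with
 (Re l * Re (G t) + Re (G t) * Re l + (Im l * Im (G t) + Im (G t) * Im l)).
- exact S.
- unfold Re, Im; simpl; ring.
Qed.

(** Integrating factor: N exp(m) is nondecreasing. *)
Lemma nonneg_derive_scaled (N dN m dm : R -> R) :
  (forall t, 0 <= t <= 1 -> is_derive N t (dN t)) ->
  (forall t, 0 <= t <= 1 -> is_derive m t (dm t)) ->
  (forall t, 0 <= t <= 1 -> 0 <= dN t + dm t * N t) ->
  N 0 * exp (m 0) <= N 1 * exp (m 1).
Proof.
intros HN Hm Hle.
apply (nonneg_derive_le (fun t => N t * exp (m t)) (fun t => (dN t + dm t * N t) * exp (m t))).
- intros t Ht. assert (A := HN t Ht). assert (B := Hm t Ht).
  assert (E : is_derive (fun s => exp (m s)) t (dm t * exp (m t))).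
  { apply (is_derive_comp exp m); [apply is_derive_exp|exact B]. }
  assert (M := is_derive_mult _ _ _ _ _ A E Rmult_comm).
  replace ((dN t + dm t * N t) * exp (m t)) with (dN t * exp (m t) + N t * (dm t * exp (m t))) by ring.
  exact M.
- intros t Ht. apply Rmult_le_pos; [apply Hle, Ht|apply Rlt_le, exp_pos].
Qed.

(** Work with |G|^2, which is differentiable without any assumption on zeros of
    G, and with the integrating factors exp(2 m) and exp(-2 m). *)
Lemma logarithmic_growth (G dG : R -> C) (m dm : R -> R) :
  (forall t, 0 <= t <= 1 -> is_derive_RC G t (dG t)) ->
  (forall t, 0 <= t <= 1 -> is_derive m t (dm t)) ->
  (forall t, 0 <= t <= 1 -> Cmod (dG t) <= dm t * Cmod (G t)) ->
  Cmod (G 0) * exp (m 0 - m 1) <= Cmod (G 1) <= Cmod (G 0) * exp (m 1 - m 0).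
Proof.
intros HG Hm Hle.
assert (K : forall t, 0 <= t <= 1 -> Rabs (2 * Re (Cconj (G t) * dG t)) <= 2 * dm t * Cmod (G t) ^ 2).
{ intros t Ht. rewrite Rabs_mult, (Rabs_pos_eq 2) by lra.
  assert (A := re_le_Cmod (Cconj (G t) * dG t)). rewrite Cmod_mult, Cmod_conj in A.
  assert (B := Hle t Ht). assert (P := Cmod_ge_0 (G t)).
  assert (C := Rmult_le_compat_l _ _ _ P B). replace (Cmod (G t) ^ 2) with (Cmod (G t) * Cmod (G t)) by ring. lra. }
assert (D : forall c, forall t, 0 <= t <= 1 -> is_derive (fun s => 2 * c * m s) t (2 * c * dm t)).
{ intros c t Ht. apply (is_derive_scal m t (2 * c)). apply Hm, Ht. }
assert (U := nonneg_derive_scaled (fun t => Cmod (G t) ^ 2) _ _ _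
   (fun t Ht => is_derive_RC_Cmod_sq G t _ (HG t Ht)) (D 1)).
assert (L := nonneg_derive_scaled (fun t => - Cmod (G t) ^ 2) _ _ _
   (fun t Ht => is_derive_opp _ _ _ (is_derive_RC_Cmod_sq G t _ (HG t Ht))) (D (-1))).
cbv beta in U, L.
assert (U' : Cmod (G 0) ^ 2 * exp (2 * 1 * m 0) <= Cmod (G 1) ^ 2 * exp (2 * 1 * m 1)).
{ apply U. intros t Ht. specialize (K t Ht). apply Rabs_le_between in K. lra. }
assert (L' : - Cmod (G 0) ^ 2 * exp (2 * -1 * m 0) <= - Cmod (G 1) ^ 2 * exp (2 * -1 * m 1)).
{ apply L. intros t Ht. specialize (K t Ht). apply Rabs_le_between in K.
  change (0 <= - (2 * Re (Cconj (G t) * dG t)) + 2 * -1 * dm t * - Cmod (G t) ^ 2). lra. }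
assert (E : forall x, exp (2 * 1 * x) = exp x ^ 2).
{ intros x. replace (2 * 1 * x) with (x + x) by ring. rewrite exp_plus. simpl. ring. }
assert (E' : forall x, exp (2 * -1 * x) = exp (- x) ^ 2).
{ intros x. replace (2 * -1 * x) with (- x + - x) by ring. rewrite exp_plus. simpl. ring. }
rewrite !E, <- !Rpow_mult_distr in U'. 
rewrite !E', <- !Ropp_mult_distr_l, <- !Rpow_mult_distr in L'.
assert (Sq : forall a b, 0 <= b -> a ^ 2 <= b ^ 2 -> a <= b).
{ intros a b Hb Hab. apply Rnot_lt_le. intros Hlt. simpl in Hab. nra. }
assert (P0 := Cmod_ge_0 (G 0)). assert (P1 := Cmod_ge_0 (G 1)).
apply Sq in U'; [|apply Rmult_le_pos; [exact P1|apply Rlt_le, exp_pos]].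
assert (L2 : Cmod (G 1) * exp (- m 1) <= Cmod (G 0) * exp (- m 0)).
{ apply Sq; [apply Rmult_le_pos; [exact P0|apply Rlt_le, exp_pos]|lra]. }
split.
- unfold Rminus. rewrite exp_plus, <- Rmult_assoc.
  apply Rle_trans with (Cmod (G 1) * exp (m 1) * exp (- m 1)).
  + apply Rmult_le_compat_r; [apply Rlt_le, exp_pos|exact U'].
  + rewrite Rmult_assoc, <- exp_plus, Rplus_opp_r, exp_0. lra.
- unfold Rminus. rewrite (Rplus_comm (m 1)), exp_plus, <- Rmult_assoc.
  apply Rle_trans with (Cmod (G 1) * exp (- m 1) * exp (m 1)).
  + rewrite Rmult_assoc, <- exp_plus, Rplus_opp_l, exp_0. lra.
  + apply Rmult_le_compat_r; [apply Rlt_le, exp_pos|exact L2].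
Qed.

(** On the radius t |-> t z the bound on F'/F reads m'(t) with
    m(t) = lambda (ln (1 + t r) - ln (1 - t r)), r = |z|. *)
Lemma preschwarzian_distortion (F dF : C -> C) (lambda : R) :
  (forall z, in_disk z -> is_derive_C F z (dF z)) ->
  (forall z, in_disk z -> F z <> 0%C) ->
  (forall z, in_disk z -> (1 - Cmod z ^ 2) * Cmod (dF z / F z) <= 2 * lambda) ->
  forall z, in_disk z ->
    Cmod (F 0%C) * Rpower ((1 - Cmod z) / (1 + Cmod z)) lambda <= Cmod (F z)
      <= Cmod (F 0%C) * Rpower ((1 + Cmod z) / (1 - Cmod z)) lambda.
Proof.
intros HF Hnz Hb z Hz. unfold in_disk in Hz. set (r := Cmod z) in *.
assert (Hr : 0 <= r) by apply Cmod_ge_0.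
assert (Ht : forall t, 0 <= t <= 1 -> Cmod (0 + RtoC t * z) = t * r /\ 0 <= t * r < 1).
{ intros t Ht. replace (0 + t * z)%C with (RtoC t * z)%C by ring.
  rewrite Cmod_mult, Cmod_R, Rabs_pos_eq by lra. fold r. split; [reflexivity|nra]. }
assert (HD : forall t, 0 <= t <= 1 -> in_disk (0 + RtoC t * z)).
{ intros t Htt. unfold in_disk. destruct (Ht t Htt) as [-> B]. lra. }
assert (Q := logarithmic_growth (fun t => F (0 + RtoC t * z)%C) (fun t => z * dF (0 + RtoC t * z))%C
  (fun t => lambda * (ln (1 + t * r) - ln (1 - t * r)))
  (fun t => 2 * lambda * r / (1 - (t * r) ^ 2))).
cbv beta in Q. replace (0 + 0 * z)%C with (RtoC 0) in Q by ring. replace (0 + 1 * z)%C with z in Q by ring.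
rewrite Rmult_0_l, Rplus_0_r, Rminus_0_r, Rminus_diag, Rmult_0_r, Rmult_1_l in Q.
assert (E1 : Rpower ((1 + r) / (1 - r)) lambda = exp (lambda * (ln (1 + r) - ln (1 - r)) - 0)).
{ unfold Rpower. rewrite ln_div by lra. f_equal. ring. }
assert (E2 : Rpower ((1 - r) / (1 + r)) lambda = exp (0 - lambda * (ln (1 + r) - ln (1 - r)))).
{ unfold Rpower. rewrite ln_div by lra. f_equal. ring. }
rewrite E1, E2. apply Q.
- intros t Htt. apply is_derive_RC_line, HF, HD, Htt.
- intros t Htt. destruct (Ht t Htt) as [_ B]. auto_derive; [lra|]. field. split; [nra|split; lra].
- intros t Htt. destruct (Ht t Htt) as [E B]. assert (D := HD t Htt).
  set (u := (0 + t * z)%C) in *.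
  assert (N := Hnz u D). specialize (Hb u D). rewrite Cmod_div in Hb by exact N. rewrite E in Hb.
  rewrite Cmod_mult. fold r. apply Cmod_gt_0 in N.
  assert (S : 0 < 1 - (t * r) ^ 2) by (simpl; nra).
  apply Rmult_le_reg_l with (1 - (t * r) ^ 2); [exact S|].
  replace ((1 - (t * r) ^ 2) * (2 * lambda * r / (1 - (t * r) ^ 2) * Cmod (F u))) with (r * (2 * lambda) * Cmod (F u)) by (field; lra).
  replace ((1 - (t * r) ^ 2) * (r * Cmod (dF u))) with (r * ((1 - (t * r) ^ 2) * (Cmod (dF u) / Cmod (F u))) * Cmod (F u)) by (field; lra).
  apply Rmult_le_compat_r; [lra|]. apply Rmult_le_compat_l; [exact Hr|exact Hb].
Qed.

Lemma unimodular_Cexp (c : C) : Cmod c = 1 ->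
  exists theta, 0 <= theta <= 2 * PI /\ Cexp (Ci * RtoC theta) = c.
Proof.
intros Hc. assert (E := Cmod2_alt c). rewrite Hc in E.
assert (B : -1 <= Re c <= 1) by (assert (H := re_le_Cmod c); rewrite Hc in H; apply Rabs_le_between in H; exact H).
assert (A := acos_bound (Re c)).
assert (Q : 1 - (Re c)² = (Im c)²) by (unfold Rsqr; simpl in E; lra).
assert (X : forall theta, Cexp (Ci * RtoC theta) = (cos theta, sin theta)).
{ intros theta. unfold Cexp; simpl. replace (0 * theta - 1 * 0) with 0 by ring.
  replace (0 * 0 + 1 * theta) with theta by ring. rewrite exp_0, !Rmult_1_l. reflexivity. }
destruct (Rle_dec 0 (Im c)) as [Hi|Hi].
- exists (acos (Re c)). split; [lra|]. rewrite X, cos_acos, sin_acos, Q by exact B.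
  rewrite sqrt_Rsqr by exact Hi. symmetry. apply surjective_pairing.
- exists (- acos (Re c) + 2 * PI). split; [lra|].
  assert (P := cos_period (- acos (Re c)) 1). assert (P' := sin_period (- acos (Re c)) 1).
  simpl INR in P, P'. rewrite Rmult_1_r in P, P'.
  rewrite X, P, P', cos_neg, sin_neg, cos_acos, sin_acos, Q by exact B.
  rewrite Rsqr_neg, sqrt_Rsqr by lra. rewrite Ropp_involutive. symmetry. apply surjective_pairing.
Qed.

(** Rotate b to the direction of a: the same c serves for the sum, and - c for
    the difference. *)
Lemma exists_aligning_unimodular (a b : C) :
  exists c, Cmod c = 1 /\ Cmod (a + c * b) = Cmod a + Cmod b /\
    Cmod (a + (- c) * b) = Rabs (Cmod a - Cmod b).
Proof.
destruct (Ceq_dec a 0) as [->|Na].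
{ exists 1%C. rewrite Cmod_1, Cmod_0. split; [reflexivity|].
  replace (0 + 1 * b)%C with b by ring. replace (0 + - (1) * b)%C with (- b)%C by ring. rewrite Cmod_opp.
  assert (H := Cmod_ge_0 b). split; [ring|]. rewrite Rabs_left1; lra. }
destruct (Ceq_dec b 0) as [->|Nb].
{ exists 1%C. rewrite Cmod_1, Cmod_0. split; [reflexivity|].
  replace (a + 1 * 0)%C with a by ring. replace (a + - (1) * 0)%C with a by ring.
  assert (H := Cmod_ge_0 a). split; [ring|]. rewrite Rabs_pos_eq; lra. }
assert (Pa : 0 < Cmod a) by (apply Cmod_gt_0; exact Na).
assert (Pb : 0 < Cmod b) by (apply Cmod_gt_0; exact Nb).
assert (Na' : RtoC (Cmod a) <> 0%C) by (intros E; apply RtoC_inj in E; lra).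
exists (a * RtoC (Cmod b) / (RtoC (Cmod a) * b))%C. repeat split.
- rewrite Cmod_div by (apply Cmult_neq_0; assumption). rewrite !Cmod_mult, !Cmod_R, !Rabs_pos_eq by lra.
  field. lra.
- replace (a + a * Cmod b / (Cmod a * b) * b)%C with (a * RtoC (1 + Cmod b / Cmod a))%C
   by (rewrite RtoC_plus, RtoC_div by lra; field; split; assumption).
  rewrite Cmod_mult, Cmod_R, Rabs_pos_eq; [field; lra|].
  assert (0 < Cmod b / Cmod a) by (apply Rdiv_lt_0_compat; assumption). lra.
- replace (a + - (a * Cmod b / (Cmod a * b)) * b)%C with (a * RtoC (1 - Cmod b / Cmod a))%C
   by (rewrite RtoC_minus, RtoC_div by lra; field; split; assumption).
  rewrite Cmod_mult, Cmod_R. rewrite <- (Rabs_pos_eq (Cmod a)) at 1 by lra. rewrite <- Rabs_mult.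
  f_equal. field. lra.
Qed.

Lemma cayley_power_real (lambda x : R) : -1 < x < 1 ->
  cayley_power lambda x = RtoC (Rpower ((1 + x) / (1 - x)) lambda).
Proof.
intros Hx. unfold cayley_power.
rewrite <- RtoC_plus, <- RtoC_minus, <- RtoC_div by lra.
apply Cpower_pos. apply Rdiv_lt_0_compat; lra.
Qed.

Lemma Re_Hfun_derive (lambda x : R) : 0 <= lambda -> -1 < x < 1 ->
  is_derive (fun s : R => Re (Hfun lambda s)) x (Rpower ((1 + x) / (1 - x)) lambda).
Proof.
intros Hl Hx.
assert (D := Hfun_derive lambda x Hl (in_disk_R x Hx)). rewrite cayley_power_real in D by exact Hx.
assert (L := is_derive_RC_line (Hfun lambda) 0 1 (RtoC (Rpower ((1 + x) / (1 - x)) lambda)) x).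
replace (0 + x * 1)%C with (RtoC x) in L by ring. specialize (L D).
apply is_derive_RC_Re in L. replace (Re (1 * RtoC (Rpower ((1 + x) / (1 - x)) lambda))) with (Rpower ((1 + x) / (1 - x)) lambda) in L by (simpl; ring).
revert L. apply is_derive_ext. intros s. do 2 f_equal. ring.
Qed.

Lemma Hfun_0 (lambda : R) : Hfun lambda 0 = 0%C.
Proof.
rewrite Hfun_real by lra. rewrite RInt_point. reflexivity.
Qed.

Lemma is_derive_RC_plus_conj (G1 G2 : R -> C) (t : R) (l1 l2 : C) :
  is_derive_RC G1 t l1 -> is_derive_RC G2 t l2 ->
  is_derive_RC (fun s => G1 s + Cconj (G2 s))%C t (l1 + Cconj l2)%C.
Proof.
intros H1 H2. apply is_derive_RC_eps. intros eps Heps.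
destruct (proj1 (is_derive_RC_eps _ _ _) H1 (eps / 2) ltac:(lra)) as [d1 [Hd1 K1]].
destruct (proj1 (is_derive_RC_eps _ _ _) H2 (eps / 2) ltac:(lra)) as [d2 [Hd2 K2]].
exists (Rmin d1 d2). split; [apply Rmin_pos; assumption|].
intros s Hs. apply Rmin_Rgt_l in Hs. destruct Hs as [S1 S2].
replace (G1 s + Cconj (G2 s) - (G1 t + Cconj (G2 t)) - (s - t)%R * (l1 + Cconj l2))%C with
 ((G1 s - G1 t - (s - t)%R * l1) + Cconj (G2 s - G2 t - (s - t)%R * l2))%C.
2:{ apply injective_projections; simpl; ring. }
eapply Rle_trans; [apply Cmod_triangle|]. rewrite Cmod_conj.
specialize (K1 s S1). specialize (K2 s S2). lra.
Qed.

(** The curve t |-> f(t z) has speed at most r (|h'| + |g'|), which the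
    hypothesis bounds by the derivative of t |-> b H(t r). *)
Lemma harmonic_growth (h g dh dg : C -> C) (b lambda : R) :
  0 <= lambda ->
  (forall z, in_disk z -> is_derive_C h z (dh z)) ->
  (forall z, in_disk z -> is_derive_C g z (dg z)) ->
  h 0%C = 0%C -> g 0%C = 0%C ->
  (forall z, in_disk z -> Cmod (dh z) + Cmod (dg z) <= b * Rpower ((1 + Cmod z) / (1 - Cmod z)) lambda) ->
  forall z, in_disk z -> Cmod (h z + Cconj (g z)) <= b * Re (Hfun lambda (RtoC (Cmod z))).
Proof.
intros Hl Hh Hg h0 g0 Hb z Hz. unfold in_disk in Hz. set (r := Cmod z) in *.
assert (Hr : 0 <= r) by apply Cmod_ge_0.
assert (Ht : forall t, 0 <= t <= 1 -> Cmod (0 + RtoC t * z) = t * r /\ 0 <= t * r < 1).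
{ intros t Ht. replace (0 + t * z)%C with (RtoC t * z)%C by ring.
  rewrite Cmod_mult, Cmod_R, Rabs_pos_eq by lra. fold r. split; [reflexivity|nra]. }
assert (HD : forall t, 0 <= t <= 1 -> in_disk (0 + RtoC t * z)).
{ intros t Htt. unfold in_disk. destruct (Ht t Htt) as [-> B]. lra. }
assert (Q := mean_value_curve (fun t => h (0 + RtoC t * z) + Cconj (g (0 + RtoC t * z)))%C
  (fun t => z * dh (0 + RtoC t * z) + Cconj (z * dg (0 + RtoC t * z)))%C
  (fun t => b * Re (Hfun lambda (RtoC (t * r))))
  (fun t => b * (r * Rpower ((1 + t * r) / (1 - t * r)) lambda))).
cbv beta in Q. replace (0 + 0 * z)%C with (RtoC 0) in Q by ring. replace (0 + 1 * z)%C with z in Q by ring.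
rewrite h0, g0, Rmult_0_l, Rmult_1_l, Hfun_0 in Q.
replace (h z + Cconj (g z) - (0 + Cconj 0))%C with (h z + Cconj (g z))%C in Q
  by (apply injective_projections; simpl; ring).
simpl (Re 0) in Q. rewrite Rmult_0_r, Rminus_0_r in Q. apply Q.
- intros t Htt. apply is_derive_RC_plus_conj; apply is_derive_RC_line; [apply Hh|apply Hg]; apply HD, Htt.
- intros t Htt. destruct (Ht t Htt) as [_ B].
  apply (is_derive_scal (fun t => Re (Hfun lambda (t * r)%R)) t b).
  apply (is_derive_comp (fun s : R => Re (Hfun lambda s)) (fun t => t * r)).
  + apply Re_Hfun_derive; [exact Hl|lra].
  + auto_derive; [exact I|ring].
- intros t Htt. destruct (Ht t Htt) as [E B]. specialize (Hb _ (HD t Htt)). rewrite E in Hb.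
  eapply Rle_trans; [apply Cmod_triangle|]. rewrite Cmod_conj, !Cmod_mult. fold r.
  replace (b * (r * Rpower ((1 + t * r) / (1 - t * r)) lambda)) with (r * (b * Rpower ((1 + t * r) / (1 - t * r)) lambda)) by ring.
  rewrite <- Rmult_plus_distr_l. apply Rmult_le_compat_l; assumption.
Qed.

(** * Lower growth of univalent harmonic mappings *)

Lemma disk_attains_min (r : R) (P : C -> Prop) (F : C -> R) :
  (exists z, Cmod z <= r /\ P z) ->
  (forall z, Cmod z <= r -> ~ P z -> exists delta, 0 < delta /\
     forall w, Cmod w <= r -> Cmod (w - z) < delta -> ~ P w) ->
  (forall z, Cmod z <= r -> forall eps, 0 < eps -> exists delta, 0 < delta /\
     forall w, Cmod w <= r -> Cmod (w - z) < delta -> Rabs (F w - F z) < eps) ->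
  exists z, Cmod z <= r /\ P z /\ forall w, Cmod w <= r -> P w -> F z <= F w.
Proof.
intros Hne Hcl Hc.
destruct (compact_attains_min (fun z => Cmod z <= r /\ P z) F r) as [z [[Hz1 Hz2] Hz3]].
- exact Hne.
- intros z [Hz _]. exact Hz.
- intros z Hz. destruct (Rle_dec (Cmod z) r) as [Hr|Hr].
  + assert (Hp : ~ P z) by tauto. destruct (Hcl z Hr Hp) as [d [Hd H]]. exists d. split; [exact Hd|].
    intros w Hw [Hw1 Hw2]. exact (H w Hw1 Hw Hw2).
  + exists (Cmod z - r). split; [lra|]. intros w Hw [Hw1 _].
    assert (A := Rabs_Cmod_minus z w). apply Rabs_le_between in A. lra.
- intros z [Hz _] eps Heps. destruct (Hc z Hz eps Heps) as [d [Hd H]]. exists d. split; [exact Hd|].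
  intros w [Hw1 _] Hw. apply H; assumption.
- exists z. split; [exact Hz1|]. split; [exact Hz2|]. intros w Hw Pw. apply Hz3. split; assumption.
Qed.

Section Univalent.
Variables (f h g dh dg : C -> C).
Hypothesis f_eq : forall z, in_disk z -> f z = (h z + Cconj (g z))%C.
Hypothesis h_derive : forall z, in_disk z -> is_derive_C h z (dh z).
Hypothesis g_derive : forall z, in_disk z -> is_derive_C g z (dg z).
Hypothesis sense_preserving : forall z, in_disk z -> Cmod (dg z) < Cmod (dh z).

Lemma harmonic_differentiable (z : C) : in_disk z -> forall eps, 0 < eps -> exists delta, 0 < delta /\
  forall w, Cmod (w - z) < delta ->
    Cmod (f w - f z - (dh z * (w - z) + Cconj (dg z * (w - z)))) <= eps * Cmod (w - z).
Proof.
intros Hz eps Heps.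
destruct (proj1 (is_derive_C_eps _ _ _) (h_derive z Hz) (eps / 2) ltac:(lra)) as [d1 [Hd1 K1]].
destruct (proj1 (is_derive_C_eps _ _ _) (g_derive z Hz) (eps / 2) ltac:(lra)) as [d2 [Hd2 K2]].
assert (Hz' := Hz). unfold in_disk in Hz'.
exists (Rmin (1 - Cmod z) (Rmin d1 d2)). split; [repeat apply Rmin_pos; lra|].
intros w Hw. apply Rmin_Rgt_l in Hw. destruct Hw as [S0 Hw]. apply Rmin_Rgt_l in Hw. destruct Hw as [S1 S2].
assert (Dw : in_disk w).
{ assert (A := Rabs_Cmod_minus z w). apply Rabs_le_between in A. unfold in_disk. lra. }
rewrite (f_eq z Hz), (f_eq w Dw).
replace (h w + Cconj (g w) - (h z + Cconj (g z)) - (dh z * (w - z) + Cconj (dg z * (w - z))))%C with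
 ((h w - h z - (w - z) * dh z) + Cconj (g w - g z - (w - z) * dg z))%C.
2:{ apply injective_projections; simpl; ring. }
eapply Rle_trans; [apply Cmod_triangle|]. rewrite Cmod_conj.
specialize (K1 w S1). specialize (K2 w S2). lra.
Qed.

Lemma harmonic_continuous (z : C) : in_disk z -> forall eps, 0 < eps -> exists delta, 0 < delta /\
  forall w, Cmod (w - z) < delta -> Cmod (f w - f z) < eps.
Proof.
intros Hz eps Heps. destruct (harmonic_differentiable z Hz 1 Rlt_0_1) as [d [Hd H]].
set (L := Cmod (dh z) + Cmod (dg z) + 1).
assert (P1 := Cmod_ge_0 (dh z)). assert (P2 := Cmod_ge_0 (dg z)).
assert (0 < eps / L) by (apply Rdiv_lt_0_compat; unfold L; lra).
exists (Rmin d (eps / L)). split; [apply Rmin_pos; assumption|].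
intros w Hw. apply Rmin_Rgt_l in Hw. destruct Hw as [W1 W2]. specialize (H w W1).
replace (f w - f z)%C with ((f w - f z - (dh z * (w - z) + Cconj (dg z * (w - z))))
  + (dh z * (w - z) + Cconj (dg z * (w - z))))%C by ring.
eapply Rle_lt_trans; [apply Cmod_triangle|].
assert (T := Cmod_triangle (dh z * (w - z)) (Cconj (dg z * (w - z)))).
rewrite Cmod_conj, !Cmod_mult in T.
apply (Rmult_lt_compat_r L) in W2; [|unfold L; lra].
replace (eps / L * L) with eps in W2 by (field; unfold L; lra). unfold L in W2. lra.
Qed.

(** The real-linear differential v |-> h' v + conj (g' v) is invertible because
    |g'| < |h'|, so some direction moves f z straight towards q. *)
Lemma harmonic_no_local_min (z q : C) (delta : R) : in_disk z -> f z <> q -> 0 < delta ->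
  exists w, Cmod (w - z) < delta /\ Cmod (f w - q) < Cmod (f z - q).
Proof.
intros Hz Hq Hdelta. set (a := dh z). set (b := dg z). set (p := (q - f z)%C).
assert (Hp : p <> 0%C).
{ intros E. apply Hq. replace q with (p + f z)%C by (unfold p; ring). rewrite E. ring. }
assert (Pp : 0 < Cmod p) by (apply Cmod_gt_0; exact Hp).
assert (S := sense_preserving z Hz). fold a b in S. assert (Pb := Cmod_ge_0 b).
assert (Delta : 0 < Cmod a ^ 2 - Cmod b ^ 2) by (simpl; nra).
assert (Delta' : (a * Cconj a - b * Cconj b)%C <> 0%C).
{ rewrite <- !Cmod2_conj, <- RtoC_minus. intros E. apply RtoC_inj in E. lra. }
(* The solution of a v + conj (b v) = p, by Cramer's rule. *)
set (v := ((Cconj a * p - Cconj b * Cconj p) / (a * Cconj a - b * Cconj b))%C).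
assert (Hv : (a * v + Cconj (b * v))%C = p).
{ unfold v. rewrite Cmult_conj, Cdiv_conj, !Cminus_conj, !Cmult_conj, !Cconj_conj by exact Delta'.
  rewrite (Cmult_comm (Cconj a) a), (Cmult_comm (Cconj b) b). field. exact Delta'. }
assert (Pv := Cmod_ge_0 v).
set (eps := Cmod p / (2 * (Cmod v + 1))).
assert (Heps : 0 < eps) by (apply Rdiv_lt_0_compat; lra).
destruct (harmonic_differentiable z Hz eps Heps) as [d [Hd H]]. fold a b in H.
set (t := Rmin 1 (Rmin (d / (Cmod v + 1)) (delta / (Cmod v + 1)))).
assert (Pd : 0 < d / (Cmod v + 1)) by (apply Rdiv_lt_0_compat; lra).
assert (Pdl : 0 < delta / (Cmod v + 1)) by (apply Rdiv_lt_0_compat; lra).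
assert (Ht : 0 < t) by (unfold t; repeat apply Rmin_pos; lra).
assert (Ht1 : t <= 1) by apply Rmin_l.
assert (Ht2 : t <= d / (Cmod v + 1)) by (eapply Rle_trans; [apply Rmin_r|apply Rmin_l]).
assert (Ht3 : t <= delta / (Cmod v + 1)) by (eapply Rle_trans; [apply Rmin_r|apply Rmin_r]).
apply (Rmult_le_compat_r (Cmod v + 1)) in Ht2; [|lra].
apply (Rmult_le_compat_r (Cmod v + 1)) in Ht3; [|lra].
replace (d / (Cmod v + 1) * (Cmod v + 1)) with d in Ht2 by (field; lra).
replace (delta / (Cmod v + 1) * (Cmod v + 1)) with delta in Ht3 by (field; lra).
exists (z + t * v)%C. specialize (H (z + t * v)%C).
replace (z + t * v - z)%C with (RtoC t * v)%C in * by ring.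
assert (Ev : Cmod (RtoC t * v) = t * Cmod v) by (rewrite Cmod_mult, Cmod_R, Rabs_pos_eq by lra; reflexivity).
rewrite Ev in *. split; [lra|]. specialize (H ltac:(lra)).
replace (a * (t * v) + Cconj (b * (t * v)))%C with (t * p)%C in H.
2:{ rewrite <- Hv. apply injective_projections; simpl; ring. }
replace (f (z + t * v)%C - q)%C with ((f (z + t * v)%C - f z - t * p) + - (RtoC (1 - t) * p))%C
  by (unfold p; rewrite RtoC_minus; ring).
replace (f z - q)%C with (- p)%C by (unfold p; ring). rewrite Cmod_opp.
eapply Rle_lt_trans; [apply Cmod_triangle|]. rewrite Cmod_opp, Cmod_mult, Cmod_R, Rabs_pos_eq by lra.
assert (E : eps * (Cmod v + 1) = Cmod p / 2) by (unfold eps; field; lra).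
assert (eps * (t * Cmod v) <= t * (Cmod p / 2)).
{ rewrite <- E. replace (t * (eps * (Cmod v + 1))) with (eps * (t * (Cmod v + 1))) by ring.
  apply Rmult_le_compat_l; [lra|]. apply Rmult_le_compat_l; lra. }
nra.
Qed.

Lemma Cmod_harmonic_linear_lower (z v : C) :
  (Cmod (dh z) - Cmod (dg z)) * Cmod v <= Cmod (dh z * v + Cconj (dg z * v)).
Proof.
assert (A := Rabs_Cmod_minus (- Cconj (dg z * v)) (dh z * v)).
apply Rabs_le_between in A. rewrite Cmod_opp, Cmod_conj, !Cmod_mult in A.
replace (dh z * v - - Cconj (dg z * v))%C with (dh z * v + Cconj (dg z * v))%C in A by ring. lra.
Qed.

Lemma Cmod_dist_continuous (q : C) (r : R) : r < 1 ->
  forall z, Cmod z <= r -> forall eps, 0 < eps -> exists delta, 0 < delta /\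
  forall w, Cmod w <= r -> Cmod (w - z) < delta -> Rabs (Cmod (f w - q) - Cmod (f z - q)) < eps.
Proof.
intros Hr z Hz eps Heps.
destruct (harmonic_continuous z ltac:(unfold in_disk; lra) eps Heps) as [d [Hd H]].
exists d. split; [exact Hd|]. intros w _ Hw.
eapply Rle_lt_trans; [apply Rabs_Cmod_minus|].
replace (f w - q - (f z - q))%C with (f w - f z)%C by ring. apply H, Hw.
Qed.

Hypothesis injective : forall z w, in_disk z -> in_disk w -> f z = f w -> z = w.
Hypothesis f_0 : f 0%C = 0%C.

(** Suppose s0 w1 = f z0 and s - s0 < 1 - s. The minimum of |f - s w1| on the
    closed disk is at most |s0 w1 - s w1| < (1 - s) |w1|, whereas on the circle
    |f - s w1| is at least (1 - s) |w1|. So the minimum is interior, hence 0, and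
    s w1 is a value too. Such a step can shrink 1 - s by the factor 2/3, and
    iterating it from s = 0 reaches every s < 1. *)
Lemma segment_in_image (r : R) (w1 : C) : 0 <= r < 1 -> w1 <> 0%C ->
  (forall z, Cmod z = r -> Cmod w1 <= Cmod (f z)) ->
  forall s, 0 <= s < 1 -> exists z, Cmod z <= r /\ f z = (RtoC s * w1)%C.
Proof.
intros Hr Hw1 Hmin.
assert (Pw : 0 < Cmod w1) by (apply Cmod_gt_0; exact Hw1).
assert (Hn : forall n s, 0 <= s <= 1 - (2 / 3) ^ n -> exists z, Cmod z <= r /\ f z = (RtoC s * w1)%C).
{ induction n as [|n IH]; intros s Hs.
  - exists 0%C. rewrite Cmod_0, f_0. split; [lra|]. simpl in Hs. replace s with 0 by lra. ring.
  (* Here 1 - s0 = (3 / 2) (1 - s), unless s0 is cut off at 0. *)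
  - simpl in Hs. set (s0 := Rmax 0 ((3 * s - 1) / 2)).
    assert (Pn : 0 < (2 / 3) ^ n) by (apply pow_lt; lra).
    assert (Pn1 : (2 / 3) ^ n <= 1) by (rewrite <- (pow1 n); apply pow_incr; lra).
    assert (Hs0 : 0 <= s0 <= 1 - (2 / 3) ^ n).
    { unfold s0. split; [apply Rmax_l|]. apply Rmax_lub; lra. }
    assert (Hs1 : s0 <= s) by (unfold s0; apply Rmax_lub; lra).
    assert (Hs2 : (3 * s - 1) / 2 <= s0) by apply Rmax_r.
    destruct (IH s0 Hs0) as [z0 [Hz0 Ez0]].
    destruct (disk_attains_min r (fun _ => True) (fun z => Cmod (f z - s * w1))) as [z [Hz [_ Hm]]].
    + exists z0. auto.
    + intros z _ H. destruct (H I).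
    + apply Cmod_dist_continuous. lra.
    + exists z. split; [exact Hz|]. apply NNPP. intros Hne.
      assert (Dz : in_disk z) by (unfold in_disk; lra).
      assert (Hb := Hm z0 Hz0 I). rewrite Ez0 in Hb.
      replace (s0 * w1 - s * w1)%C with (RtoC (- (s - s0)) * w1)%C in Hb by (rewrite RtoC_opp, RtoC_minus; ring).
      rewrite Cmod_mult, Cmod_R, Rabs_Ropp, Rabs_pos_eq in Hb by lra.
      destruct (Rle_lt_or_eq_dec _ _ Hz) as [Hlt|Heq].
      * destruct (harmonic_no_local_min z (s * w1)%C (r - Cmod z) Dz Hne ltac:(lra)) as [w [Hw1' Hw2]].
        assert (A := Rabs_Cmod_minus z w). apply Rabs_le_between in A.
        assert (B := Hm w ltac:(lra) I). lra.
      * assert (B := Hmin z Heq).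
        assert (A := Rabs_Cmod_minus (s * w1)%C (f z)). apply Rabs_le_between in A.
        rewrite Cmod_mult, Cmod_R, (Rabs_pos_eq s) in A by lra. nra. }
intros s Hs.
destruct (pow_lt_1_zero (2 / 3) ltac:(rewrite Rabs_pos_eq; lra) (1 - s) ltac:(lra)) as [n Hnn].
apply (Hn n). specialize (Hnn n (le_n n)). rewrite Rabs_pos_eq in Hnn by (apply pow_le; lra). lra.
Qed.

(** A continuous injection of a compact disk has a continuous inverse. *)
Lemma inverse_continuous (r : R) (z : C) (delta : R) : 0 <= r < 1 -> Cmod z <= r -> 0 < delta ->
  exists d, 0 < d /\ forall w, Cmod w <= r -> Cmod (f w - f z) < d -> Cmod (w - z) < delta.
Proof.
intros Hr Hz Hd.
destruct (classic (exists w, Cmod w <= r /\ delta <= Cmod (w - z))) as [Hex|Hno].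
- destruct (disk_attains_min r (fun w => delta <= Cmod (w - z)) (fun w => Cmod (f w - f z)) Hex) as [w0 [H0 [H1 H2]]].
  + intros w Hw Hlt. apply Rnot_le_lt in Hlt. exists (delta - Cmod (w - z)). split; [lra|].
    intros u Hu Huw Hle. assert (T := Cmod_triangle (u - w) (w - z)).
    replace (u - w + (w - z))%C with (u - z)%C in T by ring. lra.
  + apply Cmod_dist_continuous. lra.
  + exists (Cmod (f w0 - f z)). split.
    * apply Cmod_gt_0. intros E. assert (f w0 = f z) by (replace (f w0) with ((f w0 - f z) + f z)%C by ring; rewrite E; ring).
      apply injective in H; [|unfold in_disk; lra|unfold in_disk; lra].
      rewrite H in H1. replace (z - z)%C with (RtoC 0) in H1 by ring. rewrite Cmod_0 in H1. lra.
    * intros w Hw Hlt. apply Rnot_le_lt. intros Hle. specialize (H2 w Hw Hle). lra.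
- exists 1. split; [lra|]. intros w Hw _. apply Rnot_le_lt. intros Hle. apply Hno. exists w. auto.
Qed.

Variables m M : R -> R.
Hypothesis M_0 : M 0 = 0.
Hypothesis M_derive : forall x, 0 <= x < 1 -> is_derive M x (m x).
Hypothesis m_pos : forall x, 0 <= x < 1 -> 0 < m x.
Hypothesis stretch : forall z, in_disk z -> m (Cmod z) <= Cmod (dh z) - Cmod (dg z).

Lemma M_eps (x : R) : 0 <= x < 1 -> forall eps, 0 < eps -> exists delta, 0 < delta /\
  forall y, Rabs (y - x) < delta -> Rabs (M y - M x - (y - x) * m x) <= eps * Rabs (y - x).
Proof.
intros Hx eps Heps. destruct (M_derive x Hx) as [_ H].
destruct (H x (fun P HP => HP) (mkposreal eps Heps)) as [d Hd].
exists d. split; [apply cond_pos|]. intros y Hy. exact (Hd y Hy).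
Qed.

(** Suppose |w1| < M r and choose c < 1 with |w1| < c M r. On the compact set
    of points of the disk that f maps into [0, w1], the function |f| - c M(|z|)
    has a negative minimum, at z2 say, and z2 is not 0. Let z3 be the preimage of
    a point slightly closer to 0 on the segment; it is close to z2. Going from z2
    to z3 decreases |f| by at least about m(|z2|) |z3 - z2|, and M(|z|) by at most
    about the same amount; as c < 1, the function decreases, which contradicts
    minimality. *)
Lemma univalent_harmonic_lower_growth (z : C) : in_disk z -> M (Cmod z) <= Cmod (f z).
Proof.
intros Hz. unfold in_disk in Hz. set (r := Cmod z) in *.
assert (Hr0 : 0 <= r) by apply Cmod_ge_0.
destruct (Req_dec r 0) as [Er|Nr].
{ rewrite Er, M_0. apply Cmod_ge_0. }
assert (Hr : 0 <= r < 1) by lra.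
destruct (disk_attains_min r (fun u => Cmod u = r) (fun u => Cmod (f u - 0))) as [z1 [_ [Hz1 Hm1]]].
{ exists z. fold r. lra. }
{ intros u Hu Hne. exists (r - Cmod u). split; [lra|]. intros w _ Hw Hwr.
  assert (A := Rabs_Cmod_minus u w). apply Rabs_le_between in A. lra. }
{ apply Cmod_dist_continuous. lra. }
assert (Hm1' : forall u, Cmod u = r -> Cmod (f z1) <= Cmod (f u)).
{ intros u Hu. assert (A := Hm1 u ltac:(lra) Hu).
  replace (f z1 - 0)%C with (f z1) in A by ring. replace (f u - 0)%C with (f u) in A by ring. exact A. }
set (w1 := f z1) in *.
assert (Hw1 : w1 <> 0%C).
{ intros E. assert (z1 = 0%C).
  { apply injective; [unfold in_disk; lra|unfold in_disk; rewrite Cmod_0; lra|]. fold w1. rewrite E, f_0. reflexivity. }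
  rewrite H, Cmod_0 in Hz1. lra. }
assert (Pw : 0 < Cmod w1) by (apply Cmod_gt_0; exact Hw1).
apply Rle_trans with (Cmod w1); [|apply Hm1'; reflexivity].
apply Rnot_lt_le. intros Hlt.
set (c := (1 + Cmod w1 / M r) / 2).
assert (PM : 0 < M r) by lra.
assert (Hq : 0 < Cmod w1 / M r < 1).
{ split; [apply Rdiv_lt_0_compat; assumption|]. apply Rlt_div_l; lra. }
assert (Hc : 0 < c < 1) by (unfold c; lra).
assert (HcM : Cmod w1 < c * M r).
{ unfold c. replace ((1 + Cmod w1 / M r) / 2 * M r) with ((M r + Cmod w1) / 2) by (field; lra). lra. }
(* Membership of f u in the segment [0, w1], by closed conditions. *)
set (P := fun u => Cmod (f u) <= Cmod w1 /\ f u = (RtoC (Cmod (f u) / Cmod w1) * w1)%C).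
assert (HP : forall u s, 0 <= s <= 1 -> f u = (RtoC s * w1)%C -> Cmod (f u) = s * Cmod w1 /\ P u).
{ intros u s Hs E. assert (E' : Cmod (f u) = s * Cmod w1) by (rewrite E, Cmod_mult, Cmod_R, Rabs_pos_eq by lra; reflexivity).
  split; [exact E'|]. unfold P. rewrite E'. split; [nra|]. rewrite E. do 2 f_equal. field. lra. }
destruct (disk_attains_min r P (fun u => Cmod (f u) - c * M (Cmod u))) as [z2 [Hz2 [[P1 P2] Hm2]]].
{ exists z1. split; [lra|]. apply (HP z1 1); [lra|]. fold w1. ring. }
{ intros u Hu Hnp. apply not_and_or in Hnp.
  assert (Du : in_disk u) by (unfold in_disk; lra). destruct Hnp as [Hn|Hn].
  - apply Rnot_le_lt in Hn.
    destruct (harmonic_continuous u Du (Cmod (f u) - Cmod w1) ltac:(lra)) as [d [Hd H]].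
    exists d. split; [exact Hd|]. intros w _ Hw [Hle _]. specialize (H w Hw).
    assert (A := Rabs_Cmod_minus (f u) (f w)). apply Rabs_le_between in A. lra.
  - set (X := (f u - RtoC (Cmod (f u) / Cmod w1) * w1)%C).
    assert (PX : 0 < Cmod X).
    { apply Cmod_gt_0. intros E. apply Hn. unfold X in E.
      replace (f u) with ((f u - RtoC (Cmod (f u) / Cmod w1) * w1) + RtoC (Cmod (f u) / Cmod w1) * w1)%C at 1 by ring.
      rewrite E. ring. }
    destruct (harmonic_continuous u Du (Cmod X / 3) ltac:(lra)) as [d [Hd H]].
    exists d. split; [exact Hd|]. intros w _ Hw [_ E]. specialize (H w Hw).
    assert (A := Rabs_Cmod_minus (f u) (f w)).
    assert (B : Cmod X <= Cmod (f w - f u) + Rabs (Cmod (f w) - Cmod (f u))).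
    { replace X with (- (f w - f u) + RtoC ((Cmod (f w) - Cmod (f u)) / Cmod w1) * w1)%C.
      - eapply Rle_trans; [apply Cmod_triangle|]. rewrite Cmod_opp, Cmod_mult, Cmod_R.
        unfold Rdiv. rewrite Rabs_mult, (Rabs_pos_eq (/ Cmod w1)) by (apply Rlt_le, Rinv_0_lt_compat, Pw).
        rewrite Rmult_assoc, Rinv_l by lra. lra.
      - unfold X. rewrite E at 1. unfold Rdiv. rewrite Rmult_minus_distr_r, RtoC_minus. ring. }
    lra. }
{ intros u Hu eps Heps. assert (Du : in_disk u) by (unfold in_disk; lra).
  assert (Pu : 0 <= Cmod u < 1) by (split; [apply Cmod_ge_0|exact Du]).
  destruct (harmonic_continuous u Du (eps / 2) ltac:(lra)) as [d1 [Hd1 H1]].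
  destruct (M_eps _ Pu 1 Rlt_0_1) as [d2 [Hd2 H2]].
  assert (Pm := m_pos _ Pu). set (L := 2 * (m (Cmod u) + 1)).
  assert (PL : 0 < eps / L) by (apply Rdiv_lt_0_compat; unfold L; lra).
  exists (Rmin d1 (Rmin d2 (eps / L))). split; [repeat apply Rmin_pos; assumption|].
  intros w _ Hw. apply Rmin_Rgt_l in Hw. destruct Hw as [W1 Hw]. apply Rmin_Rgt_l in Hw. destruct Hw as [W2 W3].
  specialize (H1 w W1). assert (A := Rabs_Cmod_minus u w). assert (B := Rabs_Cmod_minus (f u) (f w)).
  specialize (H2 (Cmod w) ltac:(lra)).
  apply (Rmult_lt_compat_r L) in W3; [|unfold L; lra].
  replace (eps / L * L) with eps in W3 by (field; unfold L; lra). unfold L in W3.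
  assert (Cc : Rabs (M (Cmod w) - M (Cmod u)) <= (m (Cmod u) + 1) * Cmod (w - u)).
  { replace (M (Cmod w) - M (Cmod u)) with ((M (Cmod w) - M (Cmod u) - (Cmod w - Cmod u) * m (Cmod u)) + (Cmod w - Cmod u) * m (Cmod u)) by ring.
    eapply Rle_trans; [apply Rabs_triang|]. rewrite Rabs_mult, (Rabs_pos_eq (m (Cmod u))) by lra.
    assert (Q := Rabs_pos (Cmod w - Cmod u)). nra. }
  apply Rabs_le_between in B. apply Rabs_le_between in Cc. apply Rabs_lt_between.
  nra. }
assert (Dz2 : in_disk z2) by (unfold in_disk; lra).
assert (Px : 0 <= Cmod z2 < 1) by (split; [apply Cmod_ge_0|exact Dz2]).
assert (Hneg : Cmod (f z2) - c * M (Cmod z2) < 0).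
{ assert (A := Hm2 z1 ltac:(lra)). specialize (A ltac:(apply (HP z1 1); [lra|fold w1; ring])).
  fold w1 in A. rewrite Hz1 in A. lra. }
set (s2 := Cmod (f z2) / Cmod w1) in *.
assert (Hs2 : 0 <= s2 <= 1).
{ unfold s2. split; [apply Rmult_le_pos; [apply Cmod_ge_0|apply Rlt_le, Rinv_0_lt_compat, Pw]|apply Rle_div_l; lra]. }
assert (Ns2 : s2 <> 0).
{ intros E. rewrite E in P2. replace (0 * w1)%C with (RtoC 0) in P2 by ring.
  assert (z2 = 0%C).
  { apply injective; [exact Dz2|unfold in_disk; rewrite Cmod_0; lra|]. rewrite P2, f_0. reflexivity. }
  rewrite P2, H, !Cmod_0, M_0 in Hneg. lra. }
set (x := Cmod z2) in *. assert (Pm := m_pos x Px).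
(* Small enough for c (m x + eta) < m x - eta. *)
set (eta := m x * (1 - c) / 4). assert (Peta : 0 < eta).
{ unfold eta. assert (0 < m x * (1 - c)) by (apply Rmult_lt_0_compat; lra). lra. }
destruct (harmonic_differentiable z2 Dz2 eta Peta) as [d1 [Hd1 H1]].
destruct (M_eps x Px eta Peta) as [d2 [Hd2 H2]].
destruct (inverse_continuous r z2 (Rmin d1 d2) Hr Hz2 ltac:(apply Rmin_pos; assumption)) as [d [Hd H3]].
(* Close enough to s2 for the preimage z3 of s w1 to be close to z2. *)
set (s := Rmax 0 (s2 - d / (2 * Cmod w1))).
assert (Pd : 0 < d / (2 * Cmod w1)) by (apply Rdiv_lt_0_compat; lra).
assert (Hs : 0 <= s < s2) by (unfold s; split; [apply Rmax_l|apply Rmax_lub_lt; lra]).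
assert (Hsd : (s2 - s) * Cmod w1 < d).
{ assert (A : s2 - d / (2 * Cmod w1) <= s) by apply Rmax_r.
  apply Rle_lt_trans with (d / (2 * Cmod w1) * Cmod w1); [apply Rmult_le_compat_r; lra|].
  replace (d / (2 * Cmod w1) * Cmod w1) with (d / 2) by (field; lra). lra. }
destruct (segment_in_image r w1 Hr Hw1 Hm1' s ltac:(lra)) as [z3 [Hz3 E3]].
destruct (HP z3 s ltac:(lra) E3) as [Q3 P3].
destruct (HP z2 s2 Hs2 P2) as [Q2 _].
set (e := Cmod (f z3 - f z2)).
assert (Ee : e = Cmod (f z2) - Cmod (f z3)).
{ unfold e. rewrite Q2, Q3. rewrite E3, P2. 
  replace (s * w1 - s2 * w1)%C with (- (RtoC (s2 - s) * w1))%C by (rewrite RtoC_minus; ring).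
  rewrite Cmod_opp, Cmod_mult, Cmod_R, Rabs_pos_eq by lra. ring. }
assert (Pe : 0 < e) by (rewrite Ee, Q2, Q3; nra).
assert (Hrho := H3 z3 Hz3 ltac:(fold e; rewrite Ee, Q2, Q3; lra)).
apply Rmin_Rgt_l in Hrho. destruct Hrho as [R1 R2].
specialize (H1 z3 R1). set (rho := Cmod (z3 - z2)) in *.
assert (A := Rabs_Cmod_minus z2 z3). fold x in A. fold rho in A.
specialize (H2 (Cmod z3) ltac:(lra)).
assert (B := Cmod_harmonic_linear_lower z2 (z3 - z2)). fold rho in B.
assert (St := stretch z2 Dz2). fold x in St.
set (L := (dh z2 * (z3 - z2) + Cconj (dg z2 * (z3 - z2)))%C) in *.
assert (Prho0 : 0 <= rho) by apply Cmod_ge_0.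
assert (Le : Cmod L <= e + eta * rho).
{ replace L with ((f z3 - f z2) + - (f z3 - f z2 - L))%C by ring.
  eapply Rle_trans; [apply Cmod_triangle|]. rewrite Cmod_opp. fold e. lra. }
assert (Ge : (m x - eta) * rho <= e) by nra.
assert (Prho : 0 < rho).
{ destruct (Rle_lt_or_eq_dec _ _ Prho0) as [|E0]; [assumption|].
  exfalso. symmetry in E0. unfold rho in E0. apply Cmod_eq_0 in E0.
  assert (z3 = z2) by (replace z3 with ((z3 - z2) + z2)%C by ring; rewrite E0; ring).
  unfold e in Pe. rewrite H in Pe. replace (f z2 - f z2)%C with (RtoC 0) in Pe by ring. rewrite Cmod_0 in Pe. lra. }
assert (HM : M x - M (Cmod z3) <= (m x + eta) * rho).
{ apply Rabs_le_between in H2. assert (Q := Rabs_pos (Cmod z3 - x)).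
  assert (A' := A). apply Rabs_le_between in A'.
  assert (eta * Rabs (Cmod z3 - x) <= eta * rho) by (apply Rmult_le_compat_l; lra).
  assert ((x - Cmod z3) * m x <= rho * m x) by (apply Rmult_le_compat_r; lra). lra. }
(* Minimality at z2 bounds the loss e of |f| by c times the loss of M. *)
assert (Fin := Hm2 z3 Hz3 P3). fold x in Fin.
assert (c * (M x - M (Cmod z3)) <= c * ((m x + eta) * rho)) by (apply Rmult_le_compat_l; lra).
assert (e <= c * ((m x + eta) * rho)) by lra.
assert (K : (m x - eta) * rho <= c * (m x + eta) * rho) by lra.
apply Rmult_le_reg_r in K; [|exact Prho]. 
assert (c * eta < 1 * eta) by (apply Rmult_lt_compat_r; lra).
assert (m x * (1 - c) = 4 * eta) by (unfold eta; field). lra.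
Qed.
End Univalent.

(** * Distortion and growth in the class B_H *)

(** A finite bound excludes the branch where the norm is infinite. *)
Lemma T_norm_le_iff (h g : C -> C) (c : R) :
  Rbar_le (T_norm h g) c <->
  forall theta z, 0 <= theta <= 2 * PI -> in_disk z ->
    T_den h g theta z <> 0%C /\
    (1 - Cmod z ^ 2) * Cmod (T_num h g theta z / T_den h g theta z) <= c.
Proof.
unfold T_norm. destruct (excluded_middle_informative _) as [[t0 [z0 [Ht0 [Hz0 E0]]]]|Hno].
- split; [intros []|]. intros H. destruct (H t0 z0 Ht0 Hz0) as [N _]. destruct (N E0).
- match goal with |- Rbar_le (Lub_Rbar ?E) _ <-> _ => destruct (Lub_Rbar_correct E) as [Hub Hlub] end.
  split.
  + intros H theta z Ht Hz. split.
    * intros E. apply Hno. exists theta, z. auto.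
    * assert (A := Hub _ (ex_intro _ z (ex_intro _ theta (conj Hz (conj Ht eq_refl))))).
      exact (Rbar_le_trans _ _ _ A H).
  + intros H. apply Hlub. intros x [z [theta [Hz [Ht ->]]]]. apply (H theta z Ht Hz).
Qed.

Lemma T_derivatives (h g h1 g1 h2 g2 : C -> C) (theta : R) :
  (forall z, in_disk z -> is_derive_C h z (h1 z) /\ is_derive_C h1 z (h2 z)) ->
  (forall z, in_disk z -> is_derive_C g z (g1 z) /\ is_derive_C g1 z (g2 z)) ->
  forall z, in_disk z ->
    T_den h g theta z = (h1 z + Cexp (Ci * theta) * g1 z)%C /\
    T_num h g theta z = (h2 z + Cexp (Ci * theta) * g2 z)%C.
Proof.
intros Hh Hg z Hz.
assert (S : forall u u1 u2 : C -> C,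
  (forall w, in_disk w -> is_derive_C u w (u1 w) /\ is_derive_C u1 w (u2 w)) ->
  C_derive u z = u1 z /\ C_derive (C_derive u) z = u2 z).
{ intros u u1 u2 H.
  assert (E : forall w, in_disk w -> u1 w = C_derive u w).
  { intros w Hw. symmetry. apply is_derive_C_unique, H, Hw. }
  split; [symmetry; apply E, Hz|]. apply is_derive_C_unique.
  apply (is_derive_C_local u1); [exact Hz|exact E|apply H, Hz]. }
destruct (S h h1 h2 Hh) as [A1 A2]. destruct (S g g1 g2 Hg) as [B1 B2].
unfold T_den, T_num. rewrite A1, A2, B1, B2. split; reflexivity.
Qed.

(** The two-sided bound for h' + c g' holds for every unimodular c; take for c
    the two directions that align g'(z) with h'(z). *)
Lemma BH_distortion (lambda : R) (h g h1 g1 h2 g2 : C -> C) :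
  (forall z, in_disk z -> is_derive_C h z (h1 z) /\ is_derive_C h1 z (h2 z)) ->
  (forall z, in_disk z -> is_derive_C g z (g1 z) /\ is_derive_C g1 z (g2 z)) ->
  h1 0%C = 1%C ->
  Rbar_le (T_norm h g) (2 * lambda) ->
  forall z, in_disk z ->
    Rabs (1 - Cmod (g1 0%C)) * Rpower ((1 - Cmod z) / (1 + Cmod z)) lambda
      <= Rabs (Cmod (h1 z) - Cmod (g1 z)) /\
    Cmod (h1 z) + Cmod (g1 z)
      <= (1 + Cmod (g1 0%C)) * Rpower ((1 + Cmod z) / (1 - Cmod z)) lambda.
Proof.
intros Hh Hg h10 HT z Hz.
rewrite (T_norm_le_iff h g (2 * lambda)) in HT.
assert (Main : forall c, Cmod c = 1 ->
  Cmod (1 + c * g1 0%C) * Rpower ((1 - Cmod z) / (1 + Cmod z)) lambda <= Cmod (h1 z + c * g1 z)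
   <= Cmod (1 + c * g1 0%C) * Rpower ((1 + Cmod z) / (1 - Cmod z)) lambda).
{ intros c Hc. destruct (unimodular_Cexp c Hc) as [theta [Ht Ec]].
  rewrite <- h10.
  apply (preschwarzian_distortion (fun w => h1 w + c * g1 w)%C (fun w => h2 w + c * g2 w)%C); [| | |exact Hz].
  - intros w Hw. apply is_derive_C_plus; [apply Hh, Hw|]. apply is_derive_C_scal, Hg, Hw.
  - intros w Hw. destruct (HT theta w Ht Hw) as [N _].
    destruct (T_derivatives h g h1 g1 h2 g2 theta Hh Hg w Hw) as [E1 _]. rewrite E1, Ec in N. exact N.
  - intros w Hw. destruct (HT theta w Ht Hw) as [_ N].
    destruct (T_derivatives h g h1 g1 h2 g2 theta Hh Hg w Hw) as [E1 E2]. rewrite E1, E2, Ec in N. exact N. }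
destruct (exists_aligning_unimodular (h1 z) (g1 z)) as [c [Hc [E1 E2]]].
assert (Hc' : Cmod (- c) = 1) by (rewrite Cmod_opp; exact Hc).
split.
- destruct (Main _ Hc') as [L _]. rewrite E2 in L. eapply Rle_trans; [|apply L].
  apply Rmult_le_compat_r; [apply Rlt_le, exp_pos|].
  assert (A := Rabs_Cmod_minus (c * g1 0%C) 1).
  rewrite Cmod_mult, Hc, Rmult_1_l, Cmod_1 in A.
  replace (1 + - c * g1 0%C)%C with (1 - c * g1 0%C)%C by ring. exact A.
- destruct (Main _ Hc) as [_ U]. rewrite E1 in U. eapply Rle_trans; [apply U|].
  apply Rmult_le_compat_r; [apply Rlt_le, exp_pos|].
  eapply Rle_trans; [apply Cmod_triangle|]. rewrite Cmod_mult, Hc, Cmod_1. lra.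
Qed.

Lemma C_derive_Hfun_real (lambda x : R) : 0 <= lambda -> -1 < x < 1 ->
  C_derive (Hfun lambda) x = RtoC (Rpower ((1 + x) / (1 - x)) lambda).
Proof.
intros Hl Hx. rewrite (is_derive_C_unique _ _ _ (Hfun_derive lambda x Hl (in_disk_R x Hx))).
apply cayley_power_real, Hx.
Qed.

Lemma Re_Hfun_neg_derive (lambda x : R) : 0 <= lambda -> -1 < x < 1 ->
  is_derive (fun s : R => - Re (Hfun lambda (- s)%R)) x (Rpower ((1 - x) / (1 + x)) lambda).
Proof.
intros Hl Hx.
assert (D := Re_Hfun_derive lambda (- x) Hl ltac:(lra)).
assert (N : is_derive (fun s : R => - s) x (-1)) by (auto_derive; [exact I|ring]).
assert (K := is_derive_comp (fun s : R => Re (Hfun lambda s)) (fun s : R => - s) x _ _ D N).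
apply (is_derive_opp (V := R_NormedModule)) in K.
replace (Rpower ((1 - x) / (1 + x)) lambda) with
  (opp (scal (V := R_NormedModule) (-1) (Rpower ((1 + - x) / (1 - - x)) lambda))).
- exact K.
- change (- (-1 * Rpower ((1 + - x) / (1 - - x)) lambda) = Rpower ((1 - x) / (1 + x)) lambda).
  replace (1 - - x) with (1 + x) by ring. replace (1 + - x) with (1 - x) by ring. ring.
Qed.

(** The comparison function M(r) = - H(-r) has derivative
    ((1 - r) / (1 + r))^lambda, the lower bound for |h'| - |g'|. *)
Lemma SH0_lower_growth (lambda : R) (f h g h1 g1 : C -> C) :
  0 <= lambda ->
  in_SH0 f h g ->
  (forall z, in_disk z -> is_derive_C h z (h1 z)) ->
  (forall z, in_disk z -> is_derive_C g z (g1 z)) ->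
  (forall z, in_disk z ->
     Rpower ((1 - Cmod z) / (1 + Cmod z)) lambda <= Rabs (Cmod (h1 z) - Cmod (g1 z))) ->
  forall z, in_disk z -> - Re (Hfun lambda (RtoC (- Cmod z))) <= Cmod (f z).
Proof.
intros Hl [[_ [_ [Hf [h0 [g0 _]]]]] [Hsp [Hinj _]]] Hh Hg Hst.
assert (Hsp' : forall z, in_disk z -> Cmod (g1 z) < Cmod (h1 z)).
{ intros w Hw. rewrite <- (is_derive_C_unique _ _ _ (Hh w Hw)), <- (is_derive_C_unique _ _ _ (Hg w Hw)).
  apply Hsp, Hw. }
apply (univalent_harmonic_lower_growth f h g h1 g1 Hf Hh Hg Hsp' Hinj) with
  (m := fun x => Rpower ((1 - x) / (1 + x)) lambda) (M := fun s : R => - Re (Hfun lambda (- s)%R)).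
- rewrite (Hf _ in_disk_0), h0, g0. apply injective_projections; simpl; ring.
- rewrite Ropp_0, Hfun_0. simpl. ring.
- intros x Hx. apply Re_Hfun_neg_derive; [exact Hl|lra].
- intros x Hx. apply exp_pos.
- intros w Hw. specialize (Hst w Hw). specialize (Hsp' w Hw). rewrite Rabs_pos_eq in Hst by lra. exact Hst.
Qed.

(** * The extremal functions *)

Lemma in_disk_rotate (mu z : C) : Cmod mu = 1 -> in_disk z -> in_disk (mu * z).
Proof. intros Hmu Hz. unfold in_disk in *. rewrite Cmod_mult, Hmu. lra. Qed.

Lemma Cconj_mult_unimodular (mu : C) : Cmod mu = 1 -> (Cconj mu * mu)%C = 1%C.
Proof. intros H. rewrite Cmult_comm, <- Cmod2_conj, H. f_equal. ring. Qed.

Lemma extremal_derive (lambda : R) (mu z : C) : 0 <= lambda -> Cmod mu = 1 -> in_disk z ->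
  is_derive_C (extremal lambda mu) z (cayley_power lambda (mu * z)) /\
  is_derive_C (fun w => cayley_power lambda (mu * w)) z (mu * cayley_power_d1 lambda (mu * z))%C.
Proof.
intros Hl Hmu Hz. assert (D := in_disk_rotate mu z Hmu Hz). split.
- apply (is_derive_C_eq _ _ (Cconj mu * (mu * cayley_power lambda (mu * z)))%C).
  + apply is_derive_C_scal. apply is_derive_C_dilate. apply Hfun_derive; assumption.
  + rewrite Cmult_assoc, Cconj_mult_unimodular by exact Hmu. ring.
- apply is_derive_C_dilate. apply cayley_power_derive, D.
Qed.

Lemma cayley_power_0 (lambda : R) : cayley_power lambda 0 = 1%C.
Proof.
rewrite cayley_power_real by lra. unfold Rpower.
replace ((1 + 0) / (1 - 0)) with 1 by field. rewrite ln_1, Rmult_0_r, exp_0. reflexivity.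
Qed.

(** H''/H' = 2 lambda / (1 - z^2) and |1 - z^2| >= 1 - |z|^2. *)
Lemma extremal_in_BH (lambda : R) (mu : C) : 0 <= lambda -> Cmod mu = 1 ->
  in_BH lambda (extremal lambda mu) (extremal lambda mu) (fun _ => RtoC 0).
Proof.
intros Hl Hmu.
assert (Dh := fun z Hz => extremal_derive lambda mu z Hl Hmu Hz).
assert (Dg : forall z, in_disk z -> is_derive_C (fun _ : C => RtoC 0) z 0%C /\
   is_derive_C (fun _ : C => RtoC 0) z 0%C).
{ intros z _. split; apply is_derive_C_const. }
split.
- split; [intros z Hz; eexists; apply (Dh z Hz)|].
  split; [intros z Hz; eexists; apply (Dg z Hz)|].
  split; [intros z _; apply injective_projections; simpl; ring|].
  split; [unfold extremal; replace (mu * 0)%C with (RtoC 0) by ring; rewrite Hfun_0; ring|].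
  split; [reflexivity|].
  rewrite (is_derive_C_unique _ _ _ (proj1 (Dh 0%C in_disk_0))).
  replace (mu * 0)%C with (RtoC 0) by ring. apply cayley_power_0.
- apply (T_norm_le_iff _ _ (2 * lambda)). intros theta z Ht Hz.
  destruct (T_derivatives _ _ _ _ _ _ theta Dh Dg z Hz) as [E1 E2]. rewrite E1, E2. clear E1 E2.
  replace (cayley_power lambda (mu * z) + Cexp (Ci * theta) * 0)%C with (cayley_power lambda (mu * z)) by ring.
  replace (mu * cayley_power_d1 lambda (mu * z) + Cexp (Ci * theta) * 0)%C with (mu * cayley_power_d1 lambda (mu * z))%C by ring.
  split; [apply cayley_power_neq_0|].
  assert (D := in_disk_rotate mu z Hmu Hz).
  assert (N := disk_1_minus_sq _ D). assert (K := cayley_power_neq_0 lambda (mu * z)).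
  replace (mu * cayley_power_d1 lambda (mu * z) / cayley_power lambda (mu * z))%C with
    (mu * (RtoC (2 * lambda) / (1 - mu * z * (mu * z))))%C
    by (unfold cayley_power_d1; field; split; assumption).
  rewrite Cmod_mult, Hmu, Rmult_1_l, Cmod_div by exact N. rewrite Cmod_R, Rabs_pos_eq by lra.
  assert (T := Cmod_triangle (1 - mu * z * (mu * z)) (mu * z * (mu * z))).
  replace (1 - mu * z * (mu * z) + mu * z * (mu * z))%C with (RtoC 1) in T by ring.
  rewrite Cmod_1, !Cmod_mult, Hmu, Rmult_1_l in T. apply Cmod_gt_0 in N.
  unfold Rdiv. rewrite <- Rmult_assoc. apply Rle_div_l; [exact N|].
  rewrite Rmult_comm. apply Rmult_le_compat_l; [lra|]. simpl. lra.
Qed.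

(** For the extremal mappings, this mu turns an upper bound at z into an
    equality, and - mu a lower bound. *)
Lemma exists_rotation_to_axis (z : C) :
  exists mu, Cmod mu = 1 /\ (mu * z)%C = RtoC (Cmod z).
Proof.
destruct (Ceq_dec z 0) as [->|N].
- exists 1%C. rewrite Cmod_1, Cmod_0. split; [reflexivity|ring].
- assert (P : 0 < Cmod z) by (apply Cmod_gt_0; exact N).
  exists (RtoC (Cmod z) / z)%C. split.
  + rewrite Cmod_div by exact N. rewrite Cmod_R, Rabs_pos_eq by lra. field. lra.
  + field. exact N.
Qed.

Lemma Re_Hfun_sign (lambda r : R) : 0 <= lambda -> 0 <= r < 1 ->
  0 <= Re (Hfun lambda r) /\ 0 <= - Re (Hfun lambda (- r)%R).
Proof.
intros Hl Hr.
assert (G : forall (u du : R -> R), (forall t, 0 <= t < 1 -> is_derive u t (du t)) ->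
   (forall t, 0 <= du t) -> u 0 = 0 -> 0 <= u r).
{ intros u du Hu Hd u0.
  assert (N := nonneg_derive_le (fun t => u (t * r)) (fun t => r * du (t * r))).
  cbv beta in N. rewrite Rmult_0_l, Rmult_1_l, u0 in N. apply N.
  - intros t Ht. apply (is_derive_comp u (fun s => s * r)); [apply Hu; nra|].
    auto_derive; [exact I|ring].
  - intros t _. apply Rmult_le_pos; [lra|apply Hd]. }
split.
- apply (G (fun s => Re (Hfun lambda s)) (fun s => Rpower ((1 + s) / (1 - s)) lambda)).
  + intros t Ht. apply Re_Hfun_derive; lra.
  + intros t. apply Rlt_le, exp_pos.
  + rewrite Hfun_0. reflexivity.
- apply (G (fun s : R => - Re (Hfun lambda (- s)%R)) (fun s => Rpower ((1 - s) / (1 + s)) lambda)).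
  + intros t Ht. apply Re_Hfun_neg_derive; lra.
  + intros t. apply Rlt_le, exp_pos.
  + rewrite Ropp_0, Hfun_0. simpl. ring.
Qed.

Lemma Cmod_Hfun_real (lambda r : R) : -1 < r < 1 ->
  Cmod (Hfun lambda r) = Rabs (Re (Hfun lambda r)).
Proof. intros Hr. rewrite Hfun_real by exact Hr. apply Cmod_R. Qed.

Lemma Cmod_extremal (lambda : R) (mu z : C) : Cmod mu = 1 ->
  Cmod (extremal lambda mu z) = Cmod (Hfun lambda (mu * z)).
Proof. intros H. unfold extremal. rewrite Cmod_mult, Cmod_conj, H. ring. Qed.

(** * Sharp distortion and growth *)

Theorem theorem3p1 : forall lambda : R, 0 <= lambda ->
  (forall (f h g : C -> C) (a b : nat -> C),
     in_BH lambda f h g -> has_expansion h a -> has_expansion g b ->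
     (forall z : C, in_disk z ->
        Rabs (Cmod (C_derive h z) - Cmod (C_derive g z))
          >= Rabs (1 - Cmod (b 1%nat)) * Rpower ((1 - Cmod z) / (1 + Cmod z)) lambda
        /\ RtoC (Rabs (1 - Cmod (b 1%nat)) * Rpower ((1 - Cmod z) / (1 + Cmod z)) lambda)
           = (Rabs (1 - Cmod (b 1%nat))
              * C_derive (Hfun lambda) (RtoC (- Cmod z)))%C
        /\ Cmod (C_derive h z) + Cmod (C_derive g z)
          <= (1 + Cmod (b 1%nat)) * Rpower ((1 + Cmod z) / (1 - Cmod z)) lambda
        /\ RtoC ((1 + Cmod (b 1%nat)) * Rpower ((1 + Cmod z) / (1 - Cmod z)) lambda)
           = (RtoC (1 + Cmod (b 1%nat))
              * C_derive (Hfun lambda) (RtoC (Cmod z)))%C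
        /\ Cmod (f z) <= (1 + Cmod (b 1%nat)) * Re (Hfun lambda (RtoC (Cmod z))))
     /\ (in_SH0 f h g ->
         forall z : C, in_disk z ->
           - Re (Hfun lambda (RtoC (- Cmod z))) <= Cmod (f z)
             <= Re (Hfun lambda (RtoC (Cmod z)))))
  /\
  (let f := extremal lambda in
   let h := f in
   let g := fun _ : C => RtoC 0 in
   let b1 := C_derive g (RtoC 0) in
   (forall mu : C, Cmod mu = 1 -> in_BH lambda (f mu) (h mu) g)
   /\ forall z0 : C, in_disk z0 ->
      (exists mu : C, Cmod mu = 1 /\
         Rabs (Cmod (C_derive (h mu) z0) - Cmod (C_derive g z0))
         = Rabs (1 - Cmod b1) * Rpower ((1 - Cmod z0) / (1 + Cmod z0)) lambda)
      /\ (exists mu : C, Cmod mu = 1 /\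
         Cmod (C_derive (h mu) z0) + Cmod (C_derive g z0)
         = (1 + Cmod b1) * Rpower ((1 + Cmod z0) / (1 - Cmod z0)) lambda)
      /\ (exists mu : C, Cmod mu = 1 /\
         Cmod (f mu z0) = (1 + Cmod b1) * Re (Hfun lambda (RtoC (Cmod z0))))
      /\ (exists mu : C, Cmod mu = 1 /\
         - Re (Hfun lambda (RtoC (- Cmod z0))) = Cmod (f mu z0))
      /\ (exists mu : C, Cmod mu = 1 /\
         Cmod (f mu z0) = Re (Hfun lambda (RtoC (Cmod z0))))).
Proof.
intros lambda Hl. split.
- intros f h g a b [[Ah [Ag [Hf [h0 [g0 h'0]]]]] HT] Ea Eb.
  destruct (has_expansion_derive h a Ea) as [h1 [h2 [_ Hh]]].
  destruct (has_expansion_derive g b Eb) as [g1 [g2 [g10 Hg]]].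
  assert (Hh1 : forall z, in_disk z -> is_derive_C h z (h1 z)) by (intros z Hz; apply Hh, Hz).
  assert (Hg1 : forall z, in_disk z -> is_derive_C g z (g1 z)) by (intros z Hz; apply Hg, Hz).
  assert (h10 : h1 0%C = 1%C).
  { rewrite <- h'0. symmetry. apply is_derive_C_unique, Hh1, in_disk_0. }
  assert (Dist := BH_distortion lambda h g h1 g1 h2 g2 Hh Hg h10 HT). rewrite g10 in Dist.
  assert (Grow : forall z, in_disk z -> Cmod (f z) <= (1 + Cmod (b 1%nat)) * Re (Hfun lambda (RtoC (Cmod z)))).
  { intros z Hz. rewrite (Hf z Hz). apply (harmonic_growth h g h1 g1); try assumption.
    intros w Hw. apply (Dist w Hw). }
  split.
  + intros z Hz. destruct (Dist z Hz) as [D1 D2].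
    assert (P := Cmod_ge_0 z). assert (Hz' := Hz). unfold in_disk in Hz'.
    rewrite (is_derive_C_unique _ _ _ (Hh1 z Hz)), (is_derive_C_unique _ _ _ (Hg1 z Hz)).
    rewrite !C_derive_Hfun_real by lra.
    split; [apply Rle_ge, D1|]. split.
    { rewrite RtoC_mult. replace (1 + - Cmod z) with (1 - Cmod z) by ring.
      replace (1 - - Cmod z) with (1 + Cmod z) by ring. reflexivity. }
    split; [exact D2|]. split; [apply RtoC_mult|apply Grow, Hz].
  + intros HS z Hz.
    assert (b0 : Cmod (b 1%nat) = 0).
    { destruct HS as [_ [_ [_ E]]]. rewrite <- g10, <- (is_derive_C_unique _ _ _ (Hg1 _ in_disk_0)), E. apply Cmod_0. }
    split.
    * apply (SH0_lower_growth lambda f h g h1 g1 Hl HS Hh1 Hg1); [|exact Hz].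
      intros w Hw. destruct (Dist w Hw) as [D1 _]. rewrite b0, Rminus_0_r, Rabs_R1, Rmult_1_l in D1. exact D1.
    * assert (G := Grow z Hz). rewrite b0, Rplus_0_r, Rmult_1_l in G. exact G.
- cbv zeta. split; [intros mu Hmu; apply extremal_in_BH; assumption|].
  intros z0 Hz. assert (P := Cmod_ge_0 z0). assert (Hz' := Hz). unfold in_disk in Hz'.
  assert (G0 : forall z, C_derive (fun _ : C => RtoC 0) z = 0%C) by (intros z; apply is_derive_C_unique, is_derive_C_const).
  rewrite !G0, Cmod_0, !Rminus_0_r, !Rplus_0_r, Rabs_R1, !Rmult_1_l.
  destruct (exists_rotation_to_axis z0) as [mu [Hmu Emu]].
  assert (Hmu' : Cmod (- mu) = 1) by (rewrite Cmod_opp; exact Hmu).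
  assert (Emu' : (- mu * z0)%C = RtoC (- Cmod z0)) by (rewrite RtoC_opp, <- Emu; ring).
  destruct (Re_Hfun_sign lambda (Cmod z0) Hl ltac:(lra)) as [S1 S2].
  assert (Q : forall x : R, Cmod (RtoC (Rpower x lambda)) = Rpower x lambda).
  { intros x. rewrite Cmod_R, Rabs_pos_eq; [reflexivity|apply Rlt_le, exp_pos]. }
  assert (U : Cmod (extremal lambda mu z0) = Re (Hfun lambda (Cmod z0))).
  { rewrite Cmod_extremal, Emu, Cmod_Hfun_real, Rabs_pos_eq by (assumption || lra). reflexivity. }
  repeat split.
  + exists (- mu)%C. split; [exact Hmu'|].
    rewrite (is_derive_C_unique _ _ _ (proj1 (extremal_derive lambda (- mu) z0 Hl Hmu' Hz))), Emu'.
    rewrite cayley_power_real, Q, ?Rminus_0_r by lra.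
    rewrite Rabs_pos_eq by (apply Rlt_le, exp_pos). do 2 f_equal; ring.
  + exists mu. split; [exact Hmu|].
    rewrite (is_derive_C_unique _ _ _ (proj1 (extremal_derive lambda mu z0 Hl Hmu Hz))), Emu.
    rewrite cayley_power_real, Q by lra. ring.
  + exists mu. split; [exact Hmu|exact U].
  + exists (- mu)%C. split; [exact Hmu'|].
    rewrite Cmod_extremal, Emu', Cmod_Hfun_real by (assumption || lra).
    rewrite <- Rabs_Ropp, Rabs_pos_eq; [reflexivity|exact S2].
  + exists mu. split; [exact Hmu|exact U].
Qed.
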